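(* Let $R$ be a complete discrete valuation ring in which $2$ is invertible, with fraction field $F$. Let $E/F$ be a finite extension and let $S$ be the integral closure of $R$ in $E$. Let $M$ be a quadratic lattice over $R$ and put $\widetilde M=S\otimes_R M$. Then $$N_{E/F}\big(\theta(\mathrm O(\widetilde M))\big)\subseteq\theta(\mathrm O(M))\quad\text{and}\quad N_{E/F}\big(\theta(\mathrm O^+(\widetilde M))\big)\subseteq\theta(\mathrm O^+(M)).$$
   Context: The field $F$ has characteristic $\neq 2$. A quadratic lattice over $R$ is a finitely generated torsion-free $R$-module $M$ together with a non-degenerate quadratic form $Q$ on $V=F\otimes_R M$, with associated bilinear form satisfying $\langle x,x\rangle=Q(x)$. $\mathrm O(V)$ and $\mathrm O^+(V)$ are the orthogonal and special orthogonal groups of $V$; $\mathrm O(M)=\{\sigma\in\mathrm O(V):\sigma(M)=M\}$ and $\mathrm O^+(M)=\mathrm O(M)\cap\mathrm O^+(V)$. The spinor norm $\theta:\mathrm O(V)\to F^\times/(F^\times)^2$ is the homomorphism sending the reflection $\tau_u$ ($\tau_u(x)=x-\frac{2\langle x,u\rangle}{Q(u)}u$, $Q(u)\neq0$) to $Q(u)(F^\times)^2$. For a subset $X\subseteq\mathrm O(V)$, $\theta(X)$ is regarded as a subset of $F^\times$, a union of cosets of $(F^\times)^2$. The same definitions are applied over $S$ (a complete discrete valuation ring with fraction field $E$) to $\widetilde M$ and the quadratic space $E\otimes_F V$. $N_{E/F}:E^\times\to F^\times$ is the field norm. *)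

(* Defs.v *)
From HB Require Import structures.
From mathcomp Require Import all_boot all_order all_algebra all_field.
From mathcomp Require Import boolp classical_sets.

Set Implicit Arguments.
Unset Strict Implicit.
Unset Printing Implicit Defensive.

Import GRing.Theory.
Local Open Scope classical_set_scope.
Local Open Scope ring_scope.

Definition is_ideal (R : idomainType) (I : set R) : Prop :=
  [/\ I 0, forall x y, I x -> I y -> I (x + y)
    & forall r x, I x -> I (r * x)].

Definition principal (R : idomainType) (I : set R) : Prop :=
  exists a, I = [set r * a | r in [set: R]].

(* The maximal ideal of R, when R is local. *)
Definition nonunits (R : idomainType) : set R :=
  [set x | x \isn't a GRing.unit].

(* A local principal ideal domain that is not a field. *)
Definition dvr (R : idomainType) : Prop :=
  [/\ forall I : set R, is_ideal I -> principal I,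
      is_ideal (@nonunits R)
    & exists2 x : R, x != 0 & nonunits x].

Definition uniformizer (R : idomainType) (p : R) : Prop :=
  @nonunits R = [set r * p | r in [set: R]].

(* Congruence modulo the n-th power of the maximal ideal is divisibility of
   the difference by p ^+ n; sequences with u (n+1) = u n mod m^n suffice,
   since every m-adic Cauchy sequence has such a subsequence.  Uniqueness of
   limits is automatic in a discrete valuation ring. *)
Definition complete (R : idomainType) : Prop :=
  forall p : R, uniformizer p ->
  forall u : nat -> R,
    (forall n, exists r, u n.+1 - u n = r * p ^+ n) ->
    exists l, forall n, exists r, l - u n = r * p ^+ n.

Definition is_fraction_field (R : idomainType) (F : fieldType)
    (iota : {rmorphism R -> F}) : Prop :=
  injective iota /\
  forall x : F, exists a b, b != 0 /\ x = iota a / iota b.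

Definition fieldNorm (F : fieldType) (E : fieldExtType F) (x : E) : F :=
  \det (passmx.mxof (vbasis {:E}) (vbasis {:E}) (amull x)).

(* Quadratic spaces are taken in coordinates: V is 'rV[F]_n, and the quadratic
   form is given by the Gram matrix G of its bilinear form, which is
   normalised by <x, x> = Q x. *)
Section QuadraticSpace.

Variables (F : fieldType) (n : nat) (G : 'M[F]_n).

Definition bform (x y : 'rV[F]_n) : F := (x *m G *m y^T) 0 0.

Definition qform (x : 'rV[F]_n) : F := bform x x.

Definition nondeg_symmetric : Prop := G^T = G /\ G \in unitmx.

(* Isometries are matrices acting on row vectors on the right. *)
Definition Ogrp : set 'M[F]_n :=
  [set s | s \in unitmx /\ forall x, qform (x *m s) = qform x].

Definition SOgrp : set 'M[F]_n := [set s | Ogrp s /\ \det s = 1].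

Definition Olat (M : set 'rV[F]_n) : set 'M[F]_n :=
  [set s | Ogrp s /\ [set x *m s | x in M] = M].

Definition SOlat (M : set 'rV[F]_n) : set 'M[F]_n := Olat M `&` SOgrp.

Definition reflection (u x : 'rV[F]_n) : 'rV[F]_n :=
  x - (2%:R * bform x u / qform u) *: u.

(* The spinor norm of s, as a coset of the nonzero squares: if s is the
   composite of the reflections in u_1, ..., u_k, it is the class of
   Q(u_1) ... Q(u_k).  This is the graph of the homomorphism determined by
   its values on reflections. *)
Definition spinor_norm (s : 'M[F]_n) : set F :=
  [set c | exists (us : seq 'rV[F]_n) (a : F),
    [/\ forall u, u \in us -> qform u != 0,
        forall x, x *m s = foldr reflection x us,
        a != 0
      & c = a ^+ 2 * \prod_(u <- us) qform u]].

Definition spinor_norms (X : set 'M[F]_n) : set F :=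
  [set c | exists2 s, X s & spinor_norm s c].

End QuadraticSpace.

(* M is a finitely generated R-submodule of F^n that spans F^n: it is the set
   of R-combinations of the rows of g. *)
Definition is_lattice (R : idomainType) (F : fieldType)
    (iota : {rmorphism R -> F}) (n : nat) (M : set 'rV[F]_n) : Prop :=
  exists k (g : 'M[F]_(k, n)),
    row_full g /\ M = [set map_mx iota r *m g | r in [set: 'rV[R]_k]].

Section BaseChange.

Variables (F : fieldType) (E : fieldExtType F).

Definition extend_mx (m n : nat) (A : 'M[F]_(m, n)) : 'M[E]_(m, n) :=
  map_mx (in_alg E) A.

(* The S-span of M inside E^n, that is the image of the tensor product of
   S and M in E^n (which it embeds in when S is flat over the base ring). *)
Definition extend_lattice (S : set E) (n : nat) (M : set 'rV[F]_n) :
    set 'rV[E]_n :=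
  [set y | exists k (c : 'I_k -> E) (x : 'I_k -> 'rV[F]_n),
    [/\ forall i, S (c i), forall i, M (x i)
      & y = \sum_i c i *: extend_mx (x i)]].

End BaseChange.

Definition integral_closure (R : idomainType) (F : fieldType)
    (iota : {rmorphism R -> F}) (E : fieldExtType F) : set E :=
  [set z | integralOver (in_alg E \o iota) z].

Arguments extend_mx {F} E {m n} A.
Arguments fieldNorm {F E} x.
Arguments integral_closure {R F} iota E _.

(* Main.v *)
Require Import Defs.
From HB Require Import structures.
From mathcomp Require Import all_boot all_order all_algebra all_field.
From mathcomp Require Import perm boolp classical_sets.
From mathcomp Require Import ring.

Set Implicit Arguments.
Unset Strict Implicit.
Unset Printing Implicit Defensive.

Import GRing.Theory.
Local Open Scope classical_set_scope.
Local Open Scope ring_scope.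

(** The theorem combines a norm principle for quadratic forms over fields with
    the fact that the orthogonal group of a lattice is generated by reflections
    in vectors whose values are under control.

    As [2] is a unit, [M] is spanned by orthogonal vectors [e i] such that the
    value of each divides the values of the later ones ([dvr_diagonalize],
    [diagonal_basis]), and the same vectors span the extended lattice over the
    integral closure [S]. By Hensel's lemma ([irreducible_nonunit_01]) the ring
    [S] is local ([integral_closure_local]), so Kneser's argument
    ([kneser_generation]) writes an isometry of the extended lattice as a
    product of reflections in vectors [u] that are admissible: [u] is an
    [S]-combination of the [e i] with [j <= i], and [Q u] is a unit times [Q (e
    j)]. The spinor norm is the product of the values [Q u] up to a square,
    whichever reflections are used to compute it ([prod_qform_unique]), so it
    suffices to treat the norm of one such value.

    Write [Q u] as [Q (e j) * q] with [q] a unit of [S]. Modulo [pi] the unit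
    [q] is a value of the diagonal form [f] whose coefficients are those ratios
    [Q (e i) / Q (e j)], for [j <= i], that are units. Elements congruent to
    one have norms congruent to one, and these are squares in [R]; so up to
    squares the norm of [q] is that of a value [x] of [f] over [E].

    If [f] is isotropic modulo [pi], it represents all units of [R] up to
    squares. Otherwise it is anisotropic over [F], and Knebusch's norm
    principle ([norm_principle]) says that the norm of [x] is, up to squares, a
    product of values of [f] over [F]: if [E] has even degree over [F(x)] the
    norm is a square, and if not, Springer's theorem makes [x] a value of [f]
    over [F(x)]; then one reads the norm off a polynomial identity [f (v) = t +
    h * g], where [h] is the minimal polynomial of [x], by induction on the
    degree ([norm_principle_poly]). Being anisotropic modulo [pi], the form [f]
    takes over [F] only values that are, up to squares, unit values at vectors
    over [R].

    In both cases the norm of [Q u] is, up to squares, a product of values of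
    admissible vectors of [M], whose reflections preserve [M]
    ([fieldNorm_admissible]). Their number can be taken congruent to the degree
    of [E] over [F] modulo two, since [e j] itself is admissible; an even
    number of reflections over [E] thus yields an even number over [F], which
    settles the case of special orthogonal groups. *)

(** * Determinants *)

Lemma det_sub_mulmxC (R : comNzRingType) m n (A : 'M[R]_(m, n))
    (B : 'M[R]_(n, m)) :
  \det (1%:M - A *m B) = \det (1%:M - B *m A).
Proof.
have E1 : block_mx 1%:M A B 1%:M =
    block_mx 1%:M 0 B 1%:M *m block_mx 1%:M A 0 (1%:M - B *m A).
  by rewrite mulmx_block !mul1mx !mul0mx !mulmx1 !addr0 addrC subrK.
have E2 : block_mx 1%:M A B 1%:M =
    block_mx (1%:M - A *m B) A 0 1%:M *m block_mx 1%:M 0 B 1%:M.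
  by rewrite mulmx_block !mul1mx !mul0mx !mulmx1 ?mulmx0 ?add0r subrK.
have := congr1 determinant E1; rewrite {1}E2 !det_mulmx.
by rewrite !det_ublock !det_lblock !det1 !mul1r !mulr1.
Qed.

Lemma det_congr_tr (K : comNzRingType) n (P A : 'M[K]_n) :
  \det (P *m A *m P^T) = \det P ^+ 2 * \det A.
Proof. by rewrite !det_mulmx det_tr mulrAC -expr2. Qed.

Lemma det_mx2 (R : comNzRingType) (A : 'M[R]_2) :
  \det A = A 0 0 * A 1 1 - A 0 1 * A 1 0.
Proof.
rewrite (expand_det_row _ 0) !big_ord_recl big_ord0 /cofactor !det_mx11.
rewrite !mxE /= addr0 expr0 expr1 mul1r mulN1r mulrN.
by congr (A _ _ * A _ _ - A _ _ * A _ _); apply: val_inj.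
Qed.

(** Symmetric elimination: an antisymmetric pivot of size two has determinant
    [a ^+ 2], and its Schur complement is again antisymmetric. *)
Lemma det_skew_square (K : fieldType) n (A : 'M[K]_n) :
  (2%:R : K) != 0 -> A^T = - A -> exists c, \det A = c ^+ 2.
Proof.
move=> two_neq0; move: n {-2}n (leqnn n) A => m.
have diag0 n (B : 'M[K]_n) i : B^T = - B -> B i i = 0.
  move=> BT; apply/eqP; have := congr1 (fun M : 'M_n => M i i) BT.
  rewrite !mxE => /eqP; rewrite -addr_eq0 -mulr2n -mulr_natl mulf_eq0.
  by rewrite (negPf two_neq0).
elim: m => [|m IHm] n le_nm A skA.
  by case: n le_nm A skA => // _ A _; exists 1; rewrite det_mx00 expr1n.
case: n le_nm A skA => [|[|n]] le_nm A skA.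
- by exists 1; rewrite det_mx00 expr1n.
- by exists 0; rewrite det_mx11 diag0 // expr0n.
have [/existsP[j Aj] | noj] := boolP [exists j, A 0 j != 0]; last first.
  exists 0; rewrite expr0n /= (expand_det_row _ 0) big1 // => j _.
  by move: noj; rewrite negb_exists => /forallP/(_ j); rewrite negbK => /eqP->;
     rewrite mul0r.
pose a := A 0 j.
have [B [skB detB B01]] :
    exists B : 'M[K]_(2 + n), [/\ B^T = - B, \det B = \det A & B 0 1 = a].
  pose P : 'M[K]_(2 + n) := tperm_mx (1 : 'I_(2 + n)) j.
  have j0 : j != 0 by apply: contraNneq Aj => ->; rewrite diag0.
  have PT : P^T = P by rewrite /P tr_tperm_mx.
  have BE k l : (P *m A *m P^T) k l = A (tperm 1 j k) (tperm 1 j l).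
    by rewrite PT /P -xrowE -xcolE !mxE.
  exists (P *m A *m P^T); split.
  - apply/matrixP=> k l; rewrite mxE BE [RHS]mxE BE.
    by have /matrixP/(_ (tperm 1 j k) (tperm 1 j l)) := skA; rewrite !mxE.
  - rewrite det_congr_tr (_ : \det P ^+ 2 = 1) ?mul1r //.
    by rewrite /P det_perm -exprM mulnC exprM sqrrN !expr1n.
  - by rewrite BE tpermL tpermD // eq_sym.
pose J := ulsubmx B; pose C := ursubmx B; pose D := drsubmx B.
have ulN (M : 'M[K]_(2 + n)) : ulsubmx (- M) = - ulsubmx M.
  by apply/matrixP=> k l; rewrite !mxE.
have drN (M : 'M[K]_(2 + n)) : drsubmx (- M) = - drsubmx M.
  by apply/matrixP=> k l; rewrite !mxE.
have dlN (M : 'M[K]_(2 + n)) : dlsubmx (- M) = - dlsubmx M.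
  by apply/matrixP=> k l; rewrite !mxE.
have skJ : J^T = - J.
  by rewrite /J trmx_ulsub skB ulN.
have skD : D^T = - D by rewrite /D trmx_drsub skB drN.
have dlB : dlsubmx B = - C^T.
  by rewrite /C trmx_ursub skB dlN opprK.
have J01 : J 0 1 = a by rewrite -B01 !mxE; congr (B _ _); apply: val_inj.
have J10 : J 1 0 = - a.
  by have /matrixP/(_ 0 1) := skJ; rewrite mxE [RHS]mxE J01.
have detJ : \det J = a ^+ 2.
  by rewrite det_mx2 !diag0 // J01 J10; ring.
have uJ : J \in unitmx by rewrite unitmxE detJ unitfE expf_neq0.
pose N := D + C^T *m invmx J *m C.
have skN : N^T = - N.
  rewrite /N linearD /= skD opprD; congr (_ + _).
  rewrite !trmx_mul trmxK mulmxA trmx_inv skJ.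
  suff -> : invmx (- J) = - invmx J by rewrite mulmxN mulNmx.
  apply: (can_inj (mulmxK uJ)); rewrite mulNmx mulVmx // -[X in _ *m X]opprK.
  by rewrite mulmxN mulVmx // unitmxE -scaleN1r detZ unitrM unitrX ?unitrN1.
have BM : B = block_mx J 0 (- C^T) 1%:M *m block_mx 1%:M (invmx J *m C) 0 N.
  rewrite mulmx_block !mulmx1 !mulmx0 !mul0mx !addr0 mul1mx mulmxA mulmxV //.
  rewrite mul1mx /N addrCA mulNmx mulmxA addNr addr0 -dlB.
  by rewrite -[LHS]submxK.
have [|c detN] := IHm n _ N skN; first by rewrite -ltnS ltnW.
exists (a * c); rewrite -detB BM det_mulmx det_lblock det_ublock !det1.
by rewrite mul1r mulr1 detJ detN exprMn.
Qed.

Lemma det_skew_odd (K : fieldType) n (A : 'M[K]_n) :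
  (2%:R : K) != 0 -> A^T = - A -> odd n -> \det A = 0.
Proof.
move=> two_neq0 skA odd_n; apply/eqP; have := det_tr A.
rewrite skA -scaleN1r detZ -signr_odd odd_n mulN1r => /eqP.
by rewrite eq_sym -addr_eq0 -mulr2n -mulr_natl mulf_eq0 (negPf two_neq0).
Qed.

(** * Reflections and the spinor norm *)

Section Reflections.

Variables (K : fieldType) (n : nat) (G : 'M[K]_n).

Local Notation B := (bform G).
Local Notation Q := (qform G).

Lemma bform_mx (x y : 'rV[K]_n) : x *m G *m y^T = (B x y)%:M.
Proof. exact: mx11_scalar. Qed.

Lemma bformDl x y z : B (x + y) z = B x z + B y z.
Proof. by rewrite /bform !mulmxDl mxE. Qed.

Lemma bformZl a x z : B (a *: x) z = a * B x z.
Proof. by rewrite /bform -!scalemxAl mxE. Qed.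

Lemma bformNl x z : B (- x) z = - B x z.
Proof. by rewrite -scaleN1r bformZl mulN1r. Qed.

Lemma bform0l z : B 0 z = 0.
Proof. by rewrite -(scale0r 0) bformZl mul0r. Qed.

Lemma bform_suml (I : Type) (r : seq I) (P : pred I) (f : I -> 'rV[K]_n) z :
  B (\sum_(i <- r | P i) f i) z = \sum_(i <- r | P i) B (f i) z.
Proof.
by elim/big_rec2: _ => [|i y1 y2 _ <-]; rewrite ?bform0l ?bformDl.
Qed.

Hypothesis symG : G^T = G.

Lemma bformC x y : B x y = B y x.
Proof.
by rewrite /bform -{1}[x]trmxK -{1}symG -!trmx_mul mxE mulmxA.
Qed.

Lemma bformDr x y z : B z (x + y) = B z x + B z y.
Proof. by rewrite bformC bformDl !(bformC z). Qed.

Lemma bformZr a x z : B z (a *: x) = a * B z x.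
Proof. by rewrite bformC bformZl bformC. Qed.

Lemma bformNr x z : B z (- x) = - B z x.
Proof. by rewrite bformC bformNl bformC. Qed.

Lemma bform_sumr (I : Type) (r : seq I) (P : pred I) (f : I -> 'rV[K]_n) z :
  B z (\sum_(i <- r | P i) f i) = \sum_(i <- r | P i) B z (f i).
Proof. by rewrite bformC bform_suml; apply: eq_bigr => i _; rewrite bformC. Qed.

Lemma qformD x y : Q (x + y) = Q x + 2%:R * B x y + Q y.
Proof. by rewrite /qform !bformDl !bformDr (bformC y x); ring. Qed.

Lemma qformB x y : Q (x - y) = Q x - 2%:R * B x y + Q y.
Proof.
by rewrite qformD bformNr mulrN /qform bformNl bformNr opprK.
Qed.

Lemma qformZ a x : Q (a *: x) = a ^+ 2 * Q x.
Proof. by rewrite /qform bformZl bformZr mulrA expr2. Qed.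

(** Polarisation. *)
Lemma isometry_bform (s : 'M[K]_n) : (2%:R : K) != 0 ->
  (forall x, Q (x *m s) = Q x) -> forall x y, B (x *m s) (y *m s) = B x y.
Proof.
move=> two_neq0 sQ x y; have := sQ (x + y).
rewrite mulmxDl !qformD !sQ => /addIr/addrI/(mulfI two_neq0).
exact.
Qed.

Definition reflection_mx (u : 'rV[K]_n) : 'M[K]_n :=
  1%:M - (2%:R / Q u) *: (G *m u^T *m u).

Lemma mul_reflection_mx u x : x *m reflection_mx u = reflection G u x.
Proof.
rewrite /reflection_mx mulmxBr mulmx1 -scalemxAr !mulmxA bform_mx mul_scalar_mx.
by rewrite scalerA /reflection mulrAC.
Qed.

Lemma reflection_qform u x : Q u != 0 -> Q (reflection G u x) = Q x.
Proof.
move=> Qu; rewrite /reflection qformB qformZ bformZr expr2; field.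
exact: Qu.
Qed.

Lemma reflectionK u : Q u != 0 -> involutive (reflection G u).
Proof.
move=> Qu x; rewrite /reflection bformDl bformNl bformZl -/(Q u).
rewrite -addrA -opprD -scalerDl [X in X *: u](_ : _ = 0) ?scale0r ?subr0 //.
field.
exact: Qu.
Qed.

Lemma det_reflection_mx u : Q u != 0 -> \det (reflection_mx u) = -1.
Proof.
move=> Qu; rewrite /reflection_mx scalemxAl det_sub_mulmxC -scalemxAr mulmxA.
rewrite bform_mx -/(Q u) scale_scalar_mx divfK // det_mx11 !mxE /=.
by rewrite opprD addrA subrr add0r.
Qed.

Definition reflections_mx (us : seq 'rV[K]_n) : 'M[K]_n :=
  foldr (fun u s => s *m reflection_mx u) 1%:M us.

Lemma mul_reflections_mx us x :
  x *m reflections_mx us = foldr (reflection G) x us.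
Proof.
elim: us => [|u us IHus] /=; first exact: mulmx1.
by rewrite mulmxA IHus mul_reflection_mx.
Qed.

Lemma det_reflections_mx us : (forall u, u \in us -> Q u != 0) ->
  \det (reflections_mx us) = (-1) ^+ size us.
Proof.
elim: us => [|u us IHus] Qus /=; first by rewrite det1 expr0.
rewrite det_mulmx IHus => [|v vus]; last by rewrite Qus // inE vus orbT.
by rewrite det_reflection_mx ?Qus ?mem_head // exprSr.
Qed.

Lemma reflections_mx_Ogrp us : (forall u, u \in us -> Q u != 0) ->
  Ogrp G (reflections_mx us).
Proof.
move=> Qus; split=> [|x].
  by rewrite unitmxE det_reflections_mx // unitrX ?unitrN1.
rewrite mul_reflections_mx; elim: us Qus => [|u us IHus] //= Qus.
rewrite reflection_qform ?Qus ?mem_head // IHus // => v vus.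
by rewrite Qus // inE vus orbT.
Qed.

Lemma foldr_reflection_rev us x : (forall u, u \in us -> Q u != 0) ->
  foldr (reflection G) (foldr (reflection G) x us) (rev us) = x.
Proof.
elim: us x => [|u us IHus] x Qus //=.
rewrite rev_cons -cats1 foldr_cat /= reflectionK ?Qus ?mem_head //.
by apply: IHus => v vus; rewrite Qus // inE vus orbT.
Qed.

(** This is the Wall form of a product of reflections, in the generators [us]:
    [T] is lower triangular, with half the values [Q u] on its diagonal and the
    inner products of the vectors below it.  One more reflection borders [T] by
    a row and a column. *)
Lemma foldr_reflection_wall us : (2%:R : K) != 0 ->
    (forall u, u \in us -> Q u != 0) ->
  exists (U : 'M[K]_(size us, n)) (T : 'M[K]_(size us)),
    [/\ T + T^T = U *m G *m U^T,
        \det T = \prod_(u <- us) (Q u / 2%:R), \det T != 0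
      & forall x, foldr (reflection G) x us
          = x - x *m G *m U^T *m invmx T *m U].
Proof.
move=> two_neq0; elim: us => [|u us IHus] Qus.
  exists 0, 0; split; rewrite ?det_mx00 ?big_nil ?oner_neq0 //.
    by apply/matrixP=> - [].
  by move=> x /=; rewrite mulmx0 subr0.
have Qu : Q u != 0 by rewrite Qus ?mem_head.
have [|U [T [TT detT nzT wall]]] := IHus.
  by move=> v vus; rewrite Qus // inE vus orbT.
have uT : T \in unitmx by rewrite unitmxE unitfE.
pose w : 'cV[K]_(size us) := U *m G *m u^T.
pose q : 'M[K]_1 := (Q u / 2%:R)%:M.
pose T' : 'M[K]_(1 + size us) := block_mx q 0 w T.
pose V' : 'M[K]_(1 + size us) :=
  block_mx (2%:R / Q u)%:M 0 (- (2%:R / Q u) *: (invmx T *m w)) (invmx T).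
pose U' : 'M[K]_(1 + size us, n) := col_mx u U.
have detT' : \det T' = \prod_(v <- u :: us) (Q v / 2%:R).
  by rewrite det_lblock det_mx11 mxE eqxx mulr1n big_cons detT.
have nzT' : \det T' != 0.
  by rewrite detT' big_cons mulf_neq0 -?detT // mulf_neq0 // invr_neq0.
have uT' : T' \in unitmx by rewrite unitmxE unitfE.
have TV : T' *m V' = 1%:M.
  rewrite mulmx_block !mul0mx !mulmx0 !addr0 add0r -scalar_mxM mulmxV //.
  rewrite -scalemxAr mulmxA mulmxV // mul1mx mul_mx_scalar scaleNr subrr.
  rewrite [_ / _ * _](_ : _ = 1) -?scalar_mx_block //; field.
  by rewrite two_neq0 Qu.
have invT' : invmx T' = V' by rewrite -[RHS](mulKmx uT') TV mulmx1.
have TT' : T' + T'^T = U' *m G *m U'^T.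
  rewrite /T' /U' tr_block_mx add_block_mx tr_col_mx !mul_col_mx !mul_mx_row.
  rewrite TT trmx0 addr0 add0r /w !trmx_mul trmxK symG mulmxA.
  rewrite /q tr_scalar_mx -raddfD /= bform_mx -/(Q u) -mulrDl -mulr2n.
  by rewrite -[Q u *+ 2]mulr_natr mulfK.
have wall' x : reflection G u (foldr (reflection G) x us) =
    x - x *m G *m U'^T *m V' *m U'.
  rewrite wall /U' /V' tr_col_mx !mul_mx_row mul_row_block mul_row_col.
  set y := x - _.
  have -> : reflection G u y = y - (2%:R / Q u) *: (y *m G *m u^T *m u).
    by rewrite bform_mx mul_scalar_mx scalerA mulrAC.
  rewrite mulmx0 add0r mul_mx_scalar -scalemxAr scaleNr -scalerBr -scalemxAl.
  rewrite opprD addrA addrAC /y; congr (_ - _ *: (_ *m _)).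
  by rewrite !mulmxBl /w !mulmxA.
by exists U', T'; split=> // x; rewrite /= wall' invT'.
Qed.

(** The spinor norm of the identity is trivial.  For a product [s] of [m]
    reflections in dimension [n], exchanging the factors of a product inside a
    determinant turns [\det (1 + s)] into [2 ^+ n * \det ((T - T^T) / 2)]
    divided by [\det T].  When [s] is the identity, [\det T] is therefore the
    determinant of an antisymmetric matrix; this is a square, and it vanishes
    unless [m] is even. *)
Lemma prod_qform_square us : (2%:R : K) != 0 -> G \in unitmx ->
    (forall u, u \in us -> Q u != 0) ->
    (forall x, foldr (reflection G) x us = x) ->
  exists c, \prod_(u <- us) Q u = c ^+ 2.
Proof.
move=> two_neq0 uG Qus us1.
have [U [T [TT detT nzT wall]]] := foldr_reflection_wall two_neq0 Qus.
have uT : T \in unitmx by rewrite unitmxE unitfE.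
have UTU0 : U^T *m invmx T *m U = 0.
  apply: (can_inj (mulKmx uG)); rewrite mulmx0; apply/row_matrixP=> i.
  rewrite row0 rowE; have := wall (delta_mx 0 i).
  move/(congr1 (fun y => delta_mx 0 i - y)).
  by rewrite us1 subrr subKr !mulmxA => <-.
pose h : K := 2%:R^-1.
have detTh : \det T = \det (h *: (T - T^T)).
  have : \det (1%:M - (h *: (G *m U^T)) *m (invmx T *m U)) = 1.
    by rewrite -scalemxAl -mulmxA [U^T *m _]mulmxA UTU0 mulmx0 scaler0 subr0
      det1.
  rewrite det_sub_mulmxC => det1.
  rewrite -[LHS]mulr1 -det1 -det_mulmx mulmxBr mulmx1; congr (\det _).
  rewrite -!scalemxAr !mulmxA mulmxV // mul1mx -TT -{1}[T]scale1r.
  rewrite -(mulVf two_neq0) -/h -scalerA -scalerBr scaler_nat mulr2n opprD.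
  by rewrite addrA addrK.
have skT : (h *: (T - T^T))^T = - (h *: (T - T^T)).
  by rewrite linearZ /= linearB /= trmxK -scalerN opprB.
have [c detTc] := det_skew_square two_neq0 skT.
have even_us : ~~ odd (size us).
  by apply: contra nzT => /(det_skew_odd two_neq0 skT) det0; rewrite detTh det0.
exists (c * 2%:R ^+ (size us)./2).
rewrite exprMn -detTc -detTh detT -exprM muln2 even_halfK //.
elim: (us) => [|u vs IHvs] /=; first by rewrite !big_nil mulr1.
rewrite !big_cons exprS IHvs; field.
exact: two_neq0.
Qed.

Lemma prod_qform_unique us vs : (2%:R : K) != 0 -> G \in unitmx ->
    (forall u, u \in us -> Q u != 0) -> (forall u, u \in vs -> Q u != 0) ->
    (forall x, foldr (reflection G) x us = foldr (reflection G) x vs) ->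
  exists2 a, a != 0 & \prod_(u <- us) Q u = a ^+ 2 * \prod_(u <- vs) Q u.
Proof.
move=> two_neq0 uG Qus Qvs eq_uv.
have prod_neq0 ws : (forall u, u \in ws -> Q u != 0) ->
    \prod_(u <- ws) Q u != 0.
  by move=> Qws; rewrite prodf_seq_neq0; apply/allP=> u /Qws ->.
have [|x|c] := @prod_qform_square (rev vs ++ us) two_neq0 uG.
- by move=> u; rewrite mem_cat mem_rev => /orP[/Qvs | /Qus].
- by rewrite foldr_cat eq_uv foldr_reflection_rev.
rewrite big_cat (perm_big vs) ?perm_rev // => /= prod_uv.
have Pvs := prod_neq0 _ Qvs; have Pus := prod_neq0 _ Qus.
exists (c / \prod_(u <- vs) Q u).
  rewrite mulf_neq0 ?invr_neq0 //.
  apply: contraTneq (mulf_neq0 Pvs Pus) => c0.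
  by rewrite [X in X != 0]prod_uv c0 expr0n eqxx.
by rewrite exprMn -prod_uv expr2; field; rewrite Pvs.
Qed.

End Reflections.

(** * Complete discrete valuation rings *)

Section DVR.

Variables (R : idomainType) (pi : R).
Hypothesis dvrR : dvr R.
Hypothesis unif : uniformizer pi.

Lemma nonunitP (x : R) : reflect (exists r, x = r * pi) (x \isn't a GRing.unit).
Proof.
have E : (@nonunits R) x = [set r * pi | r in [set: R]] x by rewrite unif.
apply: (iffP idP) => [xN | [r ->]].
  have : (@nonunits R) x by [].
  by rewrite E => -[r _ <-]; exists r.
have : (@nonunits R) (r * pi) by rewrite unif; exists r.
by [].
Qed.

Lemma nonunitD (x y : R) : x \isn't a GRing.unit -> y \isn't a GRing.unit ->
  x + y \isn't a GRing.unit.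
Proof. by case: dvrR => _ [_ addN _] _; apply: addN. Qed.

Lemma nonunitMl (r x : R) : x \isn't a GRing.unit -> r * x \isn't a GRing.unit.
Proof. by case: dvrR => _ [_ _ mulN] _; apply: mulN. Qed.

Lemma nonunit_sum (I : Type) (s : seq I) (P : pred I) (f : I -> R) :
  (forall i, P i -> f i \isn't a GRing.unit) ->
  \sum_(i <- s | P i) f i \isn't a GRing.unit.
Proof.
move=> fN; elim/big_ind: _ => //; first by rewrite unitr0.
exact: nonunitD.
Qed.

Lemma unit_addN (x y : R) : x \is a GRing.unit -> y \isn't a GRing.unit ->
  x + y \is a GRing.unit.
Proof.
move=> xU yN; apply: contraTT xU => xyN; rewrite -(addrK y x).
by apply: nonunitD => //; rewrite unitrN.
Qed.

Lemma uniformizer_nonunit : pi \isn't a GRing.unit.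
Proof. by apply/nonunitP; exists 1; rewrite mul1r. Qed.

Lemma uniformizer_neq0 : pi != 0.
Proof.
case: dvrR => _ _ [x x0 /nonunitP[r xE]].
by apply: contraNneq x0 => pi0; rewrite xE pi0 mulr0.
Qed.

(** If [a] were a nonzero element divisible by every power of [pi], the
    quotients [a / pi ^+ n] would generate a strictly increasing chain of
    ideals, whose union is principal. *)
Lemma uniformizer_krull a : (forall n, exists r, a = r * pi ^+ n) -> a = 0.
Proof.
move=> a_div; have [r rE] := choice a_div.
apply/eqP/negPn/negP => a0.
have rS n : r n = r n.+1 * pi.
  apply: (mulIf (expf_neq0 n uniformizer_neq0)).
  by rewrite -mulrA -exprS -!rE.
have rD n k : exists s, r n = s * r (n + k)%N.
  elim: k => [|k [s IHs]]; first by exists 1; rewrite addn0 mul1r.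
  by exists (s * pi); rewrite IHs rS addnS -mulrA [pi * _]mulrC.
have [|b bE] := (let: And3 pid _ _ := dvrR in pid)
    [set x | exists n s, x = s * r n].
  split.
  - by exists 0%N, 0; rewrite mul0r.
  - move=> _ _ [n [s ->]] [m [t ->]]; exists (n + m)%N.
    have [s' ->] := rD n m; have [t' ->] := rD m n.
    by exists (s * s' + t * t'); rewrite [(m + n)%N]addnC mulrDl !mulrA.
  - by move=> t _ [n [s ->]]; exists n, (t * s); rewrite mulrA.
have [N [s bN]] : [set x | exists n s, x = s * r n] b.
  by rewrite bE; exists 1 => //; rewrite mul1r.
have [t _ tE] : [set t * b | t in [set: R]] (r N.+1).
  by rewrite -bE; exists N.+1, 1; rewrite mul1r.
have r0 : r N.+1 != 0 by apply: contraNneq a0 => r0; rewrite (rE N.+1) r0 mul0r.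
have /(mulIf r0) E : t * s * pi * r N.+1 = 1 * r N.+1.
  by rewrite mul1r -[RHS]tE bN (rS N); ring.
by have := nonunitMl (t * s) uniformizer_nonunit; rewrite E unitr1.
Qed.

Lemma uniformizer_factor a : a != 0 ->
  exists n u, u \is a GRing.unit /\ a = u * pi ^+ n.
Proof.
move=> a0; pose P n := `[< ~ exists r, a = r * pi ^+ n >].
have exP : exists n, P n.
  apply: contrapT => noP; move/eqP: a0; apply; apply: uniformizer_krull => n.
  by apply: contrapT => Pn; apply: noP; exists n; apply/asboolP.
case: (ex_minnP exP) => [[|n] /asboolP Pn minP].
  by case: Pn; exists a; rewrite expr0 mulr1.
have [r aE] : exists r, a = r * pi ^+ n.
  apply: contrapT => Pn'; have /minP : P n by apply/asboolP.
  by rewrite ltnn.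
exists n, r; split=> //; apply: contra_notT Pn => /nonunitP[s rE].
by exists s; rewrite aE rE exprS mulrA.
Qed.

Lemma dvr_divides_total (a b : R) :
  (exists r, a = r * b) \/ (exists r, b = r * a).
Proof.
have [->|a0] := eqVneq a 0; first by left; exists 0; rewrite mul0r.
have [->|b0] := eqVneq b 0; first by right; exists 0; rewrite mul0r.
have [n [u [uU aE]]] := uniformizer_factor a0.
have [m [v [vU bE]]] := uniformizer_factor b0.
case: (leqP n m) => [/subnK | /ltnW/subnK] E.
  right; exists (v / u * pi ^+ (m - n)).
  by rewrite aE bE mulrACA -exprD E divrK.
left; exists (u / v * pi ^+ (n - m)).
by rewrite aE bE mulrACA -exprD E divrK.
Qed.

Lemma polyZ_dvd (a : R) (f : {poly R}) :
  (forall i, exists r, f`_i = r * a) -> exists q, f = a *: q.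
Proof.
move=> /choice[r rE]; exists (\poly_(i < size f) r i); apply/polyP=> i.
rewrite coefZ coef_poly; case: ltnP => [_ | /(nth_default 0) ->].
  by rewrite rE mulrC.
by rewrite mulr0.
Qed.

Import Pdiv.Ring Pdiv.RingMonic.

(** Modulo a monic polynomial [p] the ring [R[t]] is a free module of finite
    rank over the complete ring [R], so that it is complete as well; [s] is the
    limit of the iterates of the contraction [s |-> (b - pi s ^+ 2) / 2], whose
    fixed points are the solutions. *)
Lemma sqrt_1pi_mod_monic (p b : {poly R}) :
    complete R -> (2%:R : R) \is a GRing.unit -> p \is monic ->
  exists s q, (1 + pi *: s) ^+ 2 - (1 + pi *: b) = q * p.
Proof.
move=> cR two_unit mon_p.
pose h : R := 2%:R^-1.
pose F s := rmodp (h *: (b - pi *: s ^+ 2)) p.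
pose s n := iter n F 0.
have p0 : p != 0 by apply: monic_neq0.
have sub3 (x y z : {poly R}) : x - y - (x - z) = z - y by ring.
have sz_s n : (size (s n) < size p)%N.
  by case: n => [|n] /=; rewrite ?size_poly0 ?size_poly_gt0 // /F ltn_rmodp.
have s_cauchy n : exists q, s n.+1 - s n = pi ^+ n *: q.
  elim: n => [|n [q IHq]]; first by exists (s 1%N - s 0%N);
    rewrite expr0 scale1r.
  exists (rmodp (- h *: (q * (s n.+1 + s n))) p).
  rewrite -rmodpZ // -[s n.+2]/(F (s n.+1)) -[s n.+1 in X in _ - X]/(F (s n)).
  rewrite /F -rmodpB //; congr rmodp.
  rewrite -scalerBr sub3.
  rewrite -scalerBr -[_ ^+ 2 - _]opprB subr_sqr IHq -!scalerAl exprSr.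
  by rewrite -scaleNr !scalerA; congr (_ *: _); ring.
have lim i : exists l, forall n, exists r, l - (s n)`_i = r * pi ^+ n.
  apply: cR unif _ _ => n; have [q qE] := s_cauchy n.
  by exists q`_i; rewrite -coefB qE coefZ mulrC.
have [l lE] := choice lim.
pose L := \poly_(i < size p) l i.
have LE n : exists q, L - s n = pi ^+ n *: q.
  apply: polyZ_dvd => i; rewrite coefB coef_poly; case: ltnP => [_|pi_].
    exact: lE.
  by exists 0; rewrite mul0r nth_default ?subr0 // (leq_trans (ltnW (sz_s n))).
have fixL : L = F L.
  apply/eqP; rewrite -subr_eq0; apply/eqP/polyP=> i; rewrite coef0.
  apply: uniformizer_krull => n.
  have [q1 E1] := LE n.+1; have [q E] := LE n.
  suff [q2 ->] : exists q2, L - F L = pi ^+ n *: q2.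
    by exists q2`_i; rewrite coefZ mulrC.
  exists (pi *: q1 + rmodp ((h * pi) *: (q * (L + s n))) p).
  rewrite scalerDr scalerA -exprSr -E1 -rmodpZ //.
  have -> : rmodp (pi ^+ n *: ((h * pi) *: (q * (L + s n)))) p = F (s n) - F L.
    rewrite /F -rmodpB //; congr rmodp.
    rewrite -scalerBr sub3 -scalerBr subr_sqr E -!scalerAl !scalerA.
    by congr (_ *: _); ring.
  by rewrite -[s n.+1]/(F (s n)) addrA subrK.
have [q qE] : exists q, h *: (b - pi *: L ^+ 2) = q * p + L.
  exists (rdivp (h *: (b - pi *: L ^+ 2)) p).
  by rewrite {3}fixL /F -rdivp_eq.
exists L, (- (pi * 2%:R) *: q).
have : 2%:R *: (h *: (b - pi *: L ^+ 2)) = 2%:R *: (q * p + L) by rewrite qE.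
rewrite scalerA divrr // scale1r => /(canRL (subrK _)) ->.
by rewrite -!mul_polyC !(polyCN, polyCM) polyC_natr; ring.
Qed.

End DVR.

(** * Polynomials over a discrete valuation ring *)

Lemma irredp_coprimep (K : fieldType) (p f : {poly K}) :
  irreducible_poly p -> ~~ (p %| f) -> coprimep p f.
Proof.
move=> irr_p nf; have [|gp] := irredp_XsubCP irr_p (dvdp_gcdl p f).
  by rewrite -size_poly_eq1.
by case/negP: nf; rewrite -(eqp_dvdl _ gp) dvdp_gcdr.
Qed.

Lemma irredp_dvdpM (K : fieldType) (p f g : {poly K}) :
  irreducible_poly p -> p %| f * g -> (p %| f) || (p %| g).
Proof.
move=> irr_p; have [//|/(irredp_coprimep irr_p) cpf] := boolP (p %| f).
by rewrite Gauss_dvdpr.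
Qed.

Section Valuation.

Variables (R : idomainType) (pi : R).
Hypothesis dvrR : dvr R.
Hypothesis unif : uniformizer pi.
Variables (F : fieldType) (iota : {rmorphism R -> F}).
Hypothesis fracF : is_fraction_field iota.

Definition valring : set F := [set x | exists r, x = iota r].

Lemma iota_eq0 r : (iota r == 0) = (r == 0).
Proof.
by case: fracF => inj _; rewrite -(inj_eq inj) rmorph0.
Qed.

Lemma valring0 : valring 0. Proof. by exists 0; rewrite rmorph0. Qed.

Lemma valring1 : valring 1. Proof. by exists 1; rewrite rmorph1. Qed.

Lemma valringM x y : valring x -> valring y -> valring (x * y).
Proof. by move=> [r ->] [s ->]; exists (r * s); rewrite rmorphM. Qed.

Lemma valringB x y : valring x -> valring y -> valring (x - y).
Proof. by move=> [r ->] [s ->]; exists (r - s); rewrite rmorphB. Qed.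

Lemma valringV_unit r : valring (iota r)^-1 -> r != 0 -> r \is a GRing.unit.
Proof.
move=> [s sE] r0; apply/unitrPr; exists s; case: fracF => inj _; apply: inj.
by rewrite rmorphM rmorph1 -sE divff // iota_eq0.
Qed.

Lemma valring_total x : valring x \/ valring x^-1.
Proof.
case: fracF => inj /(_ x)[a [b [b0 ->]]]; rewrite invf_div.
have [->|a0] := eqVneq a 0; first by left; rewrite rmorph0 mul0r;
  apply: valring0.
have [[r E]|[r E]] := dvr_divides_total dvrR unif a b; [left|right]; exists r.
  by rewrite E rmorphM mulfK // iota_eq0.
by rewrite E rmorphM mulfK // iota_eq0.
Qed.

(** Divisibility is a total preorder on [F], so that a finite family has a
    least member. *)
Lemma valring_min (I : eqType) (s : seq I) (x : I -> F) :
    has (fun i => x i != 0) s ->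
  exists i, [/\ i \in s, x i != 0 & forall j, j \in s -> valring (x j / x i)].
Proof.
elim: s => [|a s IHs] //=;
  have [/IHs[i [is_ xi0 xi]] _ | nos] := boolP (has _ s).
  have [xa|xa] := valring_total (x a / x i).
    exists i; split; rewrite ?inE ?is_ ?orbT // => j; rewrite inE.
    by case/orP=> [/eqP->|/xi].
  have [a0|a0] := eqVneq (x a) 0.
    exists i; split; rewrite ?inE ?is_ ?orbT // => j; rewrite inE.
    by case/orP=> [/eqP->|/xi //]; rewrite a0 mul0r; apply: valring0.
  exists a; split; rewrite ?mem_head // => j; rewrite inE.
  case/orP=> [/eqP->|/xi xj]; first by rewrite divff //; apply: valring1.
  have -> : x j / x a = x j / x i * (x a / x i)^-1 by field; rewrite a0 xi0.
  exact: valringM.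
rewrite orbF => a0; exists a; split; rewrite ?mem_head // => j; rewrite inE.
case/orP=> [/eqP->|js]; first by rewrite divff //; apply: valring1.
have /eqP-> : x j == 0 by apply: contraNT nos => xj; apply/hasP; exists j.
by rewrite mul0r; apply: valring0.
Qed.

(** All terms of this coefficient of the product but [f`_i * g`_j] involve a
    coefficient of [f] before [i] or one of [g] before [j], and hence lie in
    the maximal ideal. *)
Lemma primitive_polyM (f g : {poly R}) i j :
    f`_i \is a GRing.unit ->
    (forall k, (k < i)%N -> f`_k \isn't a GRing.unit) ->
    g`_j \is a GRing.unit ->
    (forall k, (k < j)%N -> g`_k \isn't a GRing.unit) ->
  (f * g)`_(i + j) \is a GRing.unit.
Proof.
move=> fi fk gj gk; rewrite coefM.
have ltij : (i < (i + j).+1)%N by rewrite ltnS leq_addr.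
rewrite (bigD1 (Ordinal ltij)) //= addKn; apply: unit_addN => //.
  by rewrite unitrM fi gj.
apply: nonunit_sum => // k; rewrite -val_eqE /= neq_ltn => /orP[ki | ki].
  by rewrite mulrC; apply: nonunitMl => //; apply: fk.
apply: nonunitMl => //; apply: gk.
by rewrite ltn_subLR ?ltn_add2r // -ltnS ltn_ord.
Qed.

Lemma monic_primitive (f : {poly F}) : f \is monic ->
  exists c (f' : {poly R}) i, [/\ c != 0, valring c, c *: f = map_poly iota f',
    f'`_i \is a GRing.unit & forall k, (k < i)%N -> f'`_k \isn't a GRing.unit].
Proof.
move=> mon_f; have lead1 := monicP mon_f; rewrite lead_coefE in lead1.
have sz_f : (0 < size f)%N by rewrite size_poly_gt0 monic_neq0.
have [|i0 [i0s fi0 i0min]] :=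
    @valring_min _ (seq.iota 0 (size f)) (fun i => f`_i).
  by apply/hasP; exists (size f).-1;
    rewrite ?mem_iota ?ltn_predL // lead1 oner_neq0.
have /choice[r rE] : forall j, exists r, f`_j / f`_i0 = iota r.
  move=> j; have [jf|/(nth_default 0)->] := ltnP j (size f).
    by apply: i0min; rewrite mem_iota.
  by exists 0; rewrite mul0r rmorph0.
pose f' : {poly R} := \poly_(j < size f) r j.
have f'E j : f'`_j = r j.
  rewrite coef_poly; case: ltnP => // /(nth_default 0) fj0; apply/esym/eqP.
  by rewrite -iota_eq0 -rE fj0 mul0r.
have exU : exists i, f'`_i \is a GRing.unit.
  exists i0; rewrite f'E; suff -> : r i0 = 1 by rewrite unitr1.
  by case: fracF => inj _; apply: inj; rewrite -rE divff ?rmorph1.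
case: (ex_minnP exU) => i fi imin.
exists (f`_i0)^-1, f', i; split=> //; rewrite ?invr_neq0 //.
- by exists (r (size f).-1); rewrite -rE lead1 mul1r.
- apply/polyP=> j; rewrite coefZ coef_map f'E mulrC; apply: rE.
by move=> k ki; apply: contraTN ki => /imin; rewrite -leqNgt.
Qed.

(** Gauss's lemma: if [c] and [d] in the valuation ring make [c *: f] and
    [d *: g] primitive, then [(c * d) *: h] has a unit coefficient, which makes
    [c] and [d] units. *)
Lemma monic_factor_integral (f g : {poly F}) (h : {poly R}) :
    f \is monic -> g \is monic -> f * g = map_poly iota h ->
  exists f' : {poly R}, f = map_poly iota f'.
Proof.
move=> mon_f mon_g fgh.
have [c [f' [i [c0 cV cf fi fk]]]] := monic_primitive mon_f.
have [d [g' [j [d0 [d' dE] dg gi gk]]]] := monic_primitive mon_g.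
have U := primitive_polyM fi fk gi gk.
have [c' cE] := cV.
have E : c' * d' * h`_(i + j) = (f' * g')`_(i + j).
  have : (c * d) *: map_poly iota h = map_poly iota (f' * g').
    have -> : map_poly iota (f' * g') = map_poly iota f' * map_poly iota g'.
      exact: rmorphM.
    by rewrite -cf -dg -fgh -scalerAl -scalerAr scalerA.
  move/polyP/(_ (i + j)%N); rewrite coefZ !coef_map cE dE -!rmorphM.
  by case: fracF => inj _ /inj.
have c'U : c' \is a GRing.unit by move: U; rewrite -E !unitrM => /andP[/andP[]].
exists (c'^-1 *: f');
  have -> : map_poly iota (c'^-1 *: f') = iota c'^-1 *: map_poly iota f'.
  exact: map_polyZ.
by rewrite -cf scalerA cE -rmorphM mulVr // rmorph1 scale1r.
Qed.

(** A polynomial with an invertible constant term is invertible modulo [t], and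
    therefore modulo every power of [t]. *)
Lemma bezout_Xn (g : {poly R}) a : g`_0 \is a GRing.unit ->
  exists u w, u * 'X^a + w * g = 1.
Proof.
move=> gU; elim: a => [|a [u [w uw]]].
  by exists 1, 0; rewrite mulr1 mul0r addr0.
pose e := (g`_0)^-1; pose g1 := drop_poly 1 g.
have gE : (g`_0)%:P + g1 * 'X = g.
  rewrite -[RHS](poly_take_drop 1) expr1; congr (_ + _).
  by apply/polyP=> k; rewrite coefC coef_take_poly; case: k.
have eE : e%:P * (g - g1 * 'X) = 1.
  by rewrite -[X in X - _]gE addrK -polyCM mulVr.
exists (- u * e%:P * g1), (w + u * 'X^a * e%:P).
rewrite -[RHS]uw -[X in _ = X + _]mulr1 -eE exprSr; ring.
Qed.

Lemma monic_dvd_descent (p f : {poly R}) : p \is monic ->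
  map_poly iota p %| map_poly iota f -> exists q, f = q * p.
Proof.
move=> mon_p /dvdpP[k kE].
have E := Pdiv.RingMonic.rdivp_eq mon_p f.
set q := Pdiv.Ring.rdivp f p in E; set r := Pdiv.Ring.rmodp f p in E.
exists q; suff -> : f = q * p + 0 by rewrite addr0.
rewrite E; congr (_ + _); apply/polyP=> i; rewrite coef0; apply/eqP.
case: fracF => inj _;
  have inj0 : injective (map_poly iota) := map_inj_poly inj (rmorph0 _).
suff -> : r = 0 by rewrite coef0.
apply/eqP; rewrite -(inj_eq inj0) rmorph0 -[map_poly iota r](@modp_small _ _
  (map_poly iota p)).
  have -> : map_poly iota r = (k - map_poly iota q) * map_poly iota p.
    by rewrite mulrBl -kE E rmorphD rmorphM addrC addKr.
  by rewrite modp_mull.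
rewrite !size_map_inj_poly ?rmorph0 //.
by rewrite Pdiv.CommonRing.ltn_rmodp monic_neq0.
Qed.

(** Hensel's lemma, in the form: a monic polynomial that has both roots [0] and
    [1] modulo [pi] factors.  Modulo [pi] it is [t ^ a * g] with [t ^ a] and
    [g] comaximal, which gives an idempotent [e] modulo [pi] and [p].  Then
    [1 - 2 e] is a square root of an element congruent to one modulo [pi], which
    also has a square root congruent to one.  If [p] is irreducible, the two
    agree up to sign modulo [p], which is absurd at [0] or at [1]. *)
Lemma irreducible_nonunit_01 (p : {poly R}) :
    complete R -> (2%:R : R) \is a GRing.unit ->
    p \is monic -> irreducible_poly (map_poly iota p) ->
  p.[0] \is a GRing.unit \/ p.[1] \is a GRing.unit.
Proof.
move=> cR two_unit mon_p irr_p; apply/orP/norP => -[p0N p1N].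
have inj : injective iota by case: fracF.
have exU : exists i, p`_i \is a GRing.unit.
  by exists (size p).-1; rewrite -lead_coefE (monicP mon_p) unitr1.
case: (ex_minnP exU) => a pa amin.
have a_gt0 : (0 < a)%N.
  by rewrite lt0n; apply: contraNneq p0N => a0; rewrite horner_coef0;
    move: pa; rewrite a0.
have [r rE] : exists r, take_poly a p = pi *: r.
  apply: polyZ_dvd => i; rewrite coef_take_poly.
  case: ltnP => [ia|_]; last by exists 0; rewrite mul0r.
  by apply/(nonunitP unif)/negP => /amin; rewrite leqNgt ia.
pose g := drop_poly a p.
have pE : p = pi *: r + g * 'X^a by rewrite -rE poly_take_drop.
have g1N : g.[1] \isn't a GRing.unit.
  have -> : g.[1] = p.[1] - r.[1] * pi.
    by rewrite {1}pE !hornerE /= expr1n mulr1; ring.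
  apply: nonunitD => //; rewrite unitrN.
  by apply: nonunitMl => //; apply: uniformizer_nonunit.
have [|u [w uw]] := @bezout_Xn g a; first by rewrite coef_drop_poly add0n.
pose e := u * 'X^a.
have [s [q sq]] := sqrt_1pi_mod_monic dvrR unif (4%:R *: (u * w * r)) cR
  two_unit mon_p.
have dvd_p : map_poly iota p %| map_poly iota ((1 - 2%:R * e - (1 + pi *: s))
    * (1 - 2%:R * e + (1 + pi *: s))).
  rewrite -subr_sqr; apply/dvdpP; exists (map_poly iota (- 4%:R * u * w - q)).
  rewrite -rmorphM; congr map_poly; rewrite mulrBl -sq.
  have -> : (1 - 2%:R * e) ^+ 2 = 1 - 4%:R * e * (w * g).
    have -> : w * g = 1 - e by rewrite -uw addrC addKr.
    by ring.
  rewrite {1}pE /e -!mul_polyC polyC_natr; ring.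
move: dvd_p; rewrite rmorphM.
case/(irredp_dvdpM irr_p)/orP => /(monic_dvd_descent mon_p)[k kE].
  have : (2%:R : R) \isn't a GRing.unit; last by rewrite two_unit.
  have -> : 2%:R = (2%:R * w.[1]) * g.[1] - s.[1] * pi - k.[1] * p.[1].
    have eE : e = 1 - w * g by rewrite -uw addrK.
    have := congr1 (horner^~ 1) kE; rewrite eE -!mul_polyC.
    by rewrite -polyC_natr !hornerE /= => <-; ring.
  apply: nonunitD => //; last by rewrite unitrN; apply: nonunitMl.
  apply: nonunitD => //; first exact: nonunitMl.
  by rewrite unitrN; apply: nonunitMl => //; apply: uniformizer_nonunit.
have : (2%:R : R) \isn't a GRing.unit; last by rewrite two_unit.
have -> : 2%:R = k.[0] * p.[0] - s.[0] * pi.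
  have := congr1 (horner^~ 0) kE; rewrite /e -!mul_polyC.
  rewrite -polyC_natr !hornerE /= expr0n eqn0Ngt a_gt0 /= => <-; ring.
apply: nonunitD => //; first exact: nonunitMl.
by rewrite unitrN; apply: nonunitMl => //; apply: uniformizer_nonunit.
Qed.

End Valuation.

(** * Norms of elements of a finite extension *)

Lemma horner_char_poly (K : comNzRingType) n (A : 'M[K]_n) c :
  (char_poly A).[c] = \det (c%:M - A).
Proof.
rewrite -/(horner_eval c (char_poly A)) /char_poly -det_map_mx.
congr (\det _); apply/matrixP=> i j; rewrite !mxE.
by rewrite -[LHS]/(('X *+ (i == j) - (A i j)%:P).[c]) hornerD hornerN hornerC
  hornerMn hornerX.
Qed.

(** If [p] annihilates [A], then [p(t)] is a multiple of [t - A] among matrix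
    polynomials; take determinants. *)
Lemma char_poly_dvd_annihilator (K : fieldType) n (A : 'M[K]_n.+1) p :
  horner_mx A p = 0 -> char_poly A %| p ^+ n.+1.
Proof.
have [phi [bij phiZ phiC _]] := mx_poly_ring_isom K n.
move=> /rootP/factor_theorem[q qE]; have [psi phiK psiK] := bij.
apply/dvdpP; exists (\det (psi q)); rewrite -det_scalar -det_mulmx.
congr (\det _); apply: (can_inj phiK); rewrite phiZ [map_poly _ _]qE.
by rewrite [RHS]rmorphM /= psiK rmorphB phiC phiZ map_polyX.
Qed.

Lemma dvdp_irred_exp (K : fieldType) (p f : {poly K}) n :
  irreducible_poly p -> p \is monic -> f \is monic -> f %| p ^+ n ->
  exists m, f = p ^+ m.
Proof.
move=> irr_p mon_p; elim: n f => [|n IHn] f mon_f.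
  rewrite expr0 dvdp1 => sf; exists 0%N; apply/eqP.
  by rewrite expr0 -eqp_monic ?monic1 // -size_poly_eq1.
have [/dvdpP[g fE] | nf] := boolP (p %| f).
  have mon_g : g \is monic by move: mon_f; rewrite fE monicMr.
  rewrite fE exprSr dvdp_mul2r ?irredp_neq0 // => /(IHn g mon_g)[m ->].
  by exists m.+1; rewrite exprSr.
have cop : coprimep f (p ^+ n.+1).
  by rewrite coprimep_sym coprimep_pexpl // irredp_coprimep.
move=> fp; exists 0%N; apply/eqP; rewrite expr0 -eqp_monic ?monic1 //.
exact: (coprimepP _ _ cop).
Qed.

Section FieldNorm.

Variables (F : fieldType) (E : fieldExtType F).

Local Notation n := (\dim {:E}).

Definition regular_mx (x : E) : 'M[F]_n :=
  passmx.mxof (vbasis {:E}) (vbasis {:E}) (amull x).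

Lemma regular_mx_linear : linear regular_mx.
Proof.
by move=> a x y; rewrite /regular_mx amull_is_linear passmx.mxof_linear.
Qed.

HB.instance Definition _ := GRing.isSemilinear.Build F E 'M[F]_n _ regular_mx
  (GRing.semilinear_linear regular_mx_linear).

Lemma regular_mx1 : regular_mx 1 = 1%:M.
Proof.
by rewrite /regular_mx amull1 passmx.mxof1 // (basis_free (vbasisP _)).
Qed.

Lemma regular_mxM x y : regular_mx (x * y) = regular_mx x *m regular_mx y.
Proof. rewrite /regular_mx -passmx.mxof_comp ?vbasisP //.
by congr passmx.mxof; apply/lfunP=> w;
  rewrite comp_lfunE !lfunE /= mulrCA mulrA. Qed.

Lemma fieldNormM (x y : E) : fieldNorm (x * y) = fieldNorm x * fieldNorm y.
Proof. by rewrite -det_mulmx -regular_mxM. Qed.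

Lemma fieldNorm1 : fieldNorm (1 : E) = 1.
Proof. by rewrite -[LHS]/(\det (regular_mx 1)) regular_mx1 det1. Qed.

Lemma fieldNorm_neq0 (x : E) : x != 0 -> fieldNorm x != 0.
Proof.
move=> x0; apply: contraNneq (oner_neq0 F) => Nx0.
by rewrite -fieldNorm1 -(divff x0) fieldNormM Nx0 mul0r.
Qed.

Lemma fieldNormV (x : E) : x != 0 -> fieldNorm x^-1 = (fieldNorm x)^-1.
Proof.
move=> x0; apply: (mulfI (fieldNorm_neq0 x0)).
by rewrite -fieldNormM !divff ?fieldNorm1 ?fieldNorm_neq0.
Qed.

Lemma fieldNorm_alg (c : F) : fieldNorm (c%:A : E) = c ^+ n.
Proof.
rewrite -[LHS]/(\det (regular_mx c%:A)) linearZ /= regular_mx1.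
by rewrite scalemx1 det_scalar.
Qed.

Lemma minPoly1E (x : E) : exists p : {poly F},
  [/\ minPoly 1 x = map_poly (in_alg E) p, p \is monic & irreducible_poly p].
Proof.
have /polyOver1P[p pE] := minPolyOver 1 x.
have mon_p : p \is monic by rewrite -(map_monic (in_alg E)) -pE monic_minPoly.
exists p; split=> //; split=> [|q sq qp].
  rewrite -(size_map_poly (in_alg E)) -pE size_minPoly ltnS.
  by rewrite adjoin_degreeE divn_gt0 ?adim_gt0 // dimvS ?subv_adjoin.
have := @minPoly_irr _ _ 1%AS x (map_poly (in_alg E) q) (alg_polyOver _ _).
rewrite pE dvdp_map => /(_ qp)/orP[|]; first by rewrite eqp_map.
by rewrite -size_poly_eq1 size_map_poly (negPf sq).
Qed.

(** The characteristic polynomial of the multiplication by [x] is a monic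
    divisor of a power of the minimal polynomial, hence a power of it; the
    exponent is read off the degrees. *)
Lemma fieldNorm_minPoly (x : E) (p : {poly F}) (c : F) :
    minPoly 1 x = map_poly (in_alg E) p ->
  fieldNorm (c%:A - x) = p.[c] ^+ (\dim_(<<1; x>>) {:E}).
Proof.
move=> pE; have [p1 [p1E mon_p irr_p]] := minPoly1E x.
have p1p : p1 = p.
  by apply: (map_poly_inj (in_alg E)); rewrite -p1E -pE.
rewrite p1p in mon_p irr_p.
have px0 : (map_poly (in_alg E) p).[x] = 0 by rewrite -pE minPolyxx.
have dvd_p : char_poly (regular_mx x) %| p ^+ n.
  have : (0 < n)%N by rewrite adim_gt0.
  move: n regular_mx regular_mx_linear regular_mxM regular_mx1.
  case=> [|k] // r lin_r rM r1 _; apply: char_poly_dvd_annihilator.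
  have r0 : r 0 = 0.
    by have := lin_r (-1) 0 0; rewrite scaler0 addr0 scaleN1r addNr.
  suff -> : horner_mx (r x) p = r (map_poly (in_alg E) p).[x] by rewrite px0.
  elim/poly_ind: (p) => [|q a IHq]; first by rewrite !rmorph0 horner0 r0.
  rewrite !rmorphD !rmorphM /= horner_mx_X horner_mx_C map_polyX map_polyC /=.
  by rewrite hornerMXaddC addrC [in RHS]addrC lin_r rM r1 IHq scalemx1.
have [m mE] := dvdp_irred_exp irr_p mon_p (char_poly_monic _) dvd_p.
have NE : fieldNorm (c%:A - x) = p.[c] ^+ m.
  rewrite -horner_exp -mE horner_char_poly -scalemx1 -regular_mx1.
  by rewrite -linearZ /= -linearB.
rewrite NE; congr (_ ^+ _).
have sz_p : size p = (adjoin_degree 1 x).+1.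
  by rewrite -(size_map_poly (in_alg E)) -pE size_minPoly.
have := congr1 predn (size_char_poly (regular_mx x)).
rewrite mE size_exp sz_p /= => /eqP.
have adj_gt0 : (0 < adjoin_degree 1 x)%N.
  by rewrite adjoin_degreeE divn_gt0 ?adim_gt0 // dimvS ?subv_adjoin.
rewrite [X in _ == X](dim_sup_field (subvf <<1; x>>)) dim_Fadjoin dimv1 muln1.
by rewrite mulnC eqn_pmul2r // => /eqP.
Qed.

End FieldNorm.

(** * The integral closure *)

Section IntegralClosure.

Variables (R : idomainType) (pi : R).
Hypotheses (dvrR : dvr R) (unif : uniformizer pi) (cR : complete R).
Hypothesis two_unit : (2%:R : R) \is a GRing.unit.
Variables (F : fieldType) (iota : {rmorphism R -> F}).
Hypothesis fracF : is_fraction_field iota.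
Variable E : fieldExtType F.

Local Notation S := (integral_closure iota E).
Local Notation V := (valring iota).

Lemma integral_closureM x y : S x -> S y -> S (x * y).
Proof. exact: integral_mul. Qed.

Lemma integral_closureB x y : S x -> S y -> S (x - y).
Proof. exact: integral_sub. Qed.

Lemma integral_closure_valring x : V x -> S x%:A.
Proof. by move=> [r ->]; apply: (integral_id (in_alg E \o iota)). Qed.

Lemma integral_closure1 : S 1.
Proof. by rewrite -(scale1r 1); apply/integral_closure_valring/valring1. Qed.

Lemma minPoly_integral (z : E) : S z -> exists p : {poly R},
  [/\ p \is monic, irreducible_poly (map_poly iota p)
    & minPoly 1 z = map_poly (in_alg E) (map_poly iota p)].
Proof.
have [inj _] := fracF; move=> [q mon_q qz0].
have [p0 [p0E mon_p0 irr_p0]] := minPoly1E z.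
have : map_poly (in_alg E) p0 %| map_poly (in_alg E) (map_poly iota q).
  rewrite -p0E minPoly_dvdp ?alg_polyOver //.
  by rewrite -map_poly_comp.
rewrite dvdp_map => /dvdpP[g gE].
have mon_g : g \is monic.
  by rewrite -(monicMr _ mon_p0) -gE; apply: monic_map.
have [|p pE] := monic_factor_integral dvrR unif fracF mon_p0 mon_g (h := q).
  by rewrite mulrC -gE.
exists p; rewrite -pE; split=> //.
by rewrite monicE -(inj_eq inj) -lead_coef_map_inj ?rmorph0 // -pE (monicP
  mon_p0) rmorph1.
Qed.

Lemma horner_integral (p : {poly R}) (z : E) : S z ->
  S (map_poly (in_alg E) (map_poly iota p)).[z].
Proof.
move=> Sz; apply: integral_horner => //; apply/integral_poly => i.
by rewrite !coef_map; apply: (integral_id (in_alg E \o iota)).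
Qed.

(** Since [p] vanishes at [z], dividing [p - p(c)] by [t - c] exhibits [- p(c)]
    as a multiple of [z - c] in [R[z]]. *)
Lemma integral_closure_inv (p : {poly R}) (z : E) (c : R) : S z ->
    minPoly 1 z = map_poly (in_alg E) (map_poly iota p) ->
    p.[c] \is a GRing.unit ->
  z != (iota c)%:A /\ S (z - (iota c)%:A)^-1.
Proof.
move=> Sz pE pcU.
have /factor_theorem[q qE] : root (p - p.[c]%:P) c.
  by rewrite rootE !hornerE subrr.
pose j := in_alg E \o iota.
have E1 : - j p.[c] = (map_poly j q).[z] * (z - j c).
  have : (map_poly j (p - p.[c]%:P)).[z] = (map_poly j (q * ('X - c%:P))).[z].
    by rewrite qE.
  rewrite rmorphB rmorphM rmorphB /= map_polyX !map_polyC /= !hornerE.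
  have -> : (map_poly j p).[z] = 0 by rewrite /j map_poly_comp -pE minPolyxx.
  by rewrite sub0r.
have pc0 : - j p.[c] != 0 by rewrite oppr_eq0 -unitfE rmorph_unit.
have zc0 : z - j c != 0 by apply: contraNneq pc0 => z0; rewrite E1 z0 mulr0.
rewrite -[(iota c)%:A]/(j c) -subr_eq0; split=> //.
have -> : (z - j c)^-1 = (map_poly j q).[z] * j (- (p.[c])^-1).
  apply: (mulfI zc0); rewrite divff // mulrCA mulrA -[X in X * _]E1.
  by rewrite -rmorphN -rmorphM mulrNN divrr // rmorph1.
apply: integral_closureM; last exact: integral_id.
by rewrite /j map_poly_comp; apply: horner_integral.
Qed.

(** Otherwise the minimal polynomial of [z], which is irreducible, would have
    both roots [0] and [1] modulo [pi]. *)
Lemma integral_closure_local (z : E) : S z ->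
  (z != 0 /\ S z^-1) \/ (1 - z != 0 /\ S (1 - z)^-1).
Proof.
move=> Sz; have [p [mon_p irr_p pE]] := minPoly_integral Sz.
have [pU|pU] := irreducible_nonunit_01 dvrR unif fracF cR two_unit mon_p irr_p.
  have := integral_closure_inv Sz pE pU.
  by rewrite rmorph0 scale0r subr0; left.
have := integral_closure_inv Sz pE pU.
rewrite rmorph1 scale1r -subr_eq0 => -[z1 Sz1]; right.
rewrite -opprB oppr_eq0 invrN; split=> //.
by rewrite -[X in S X]mulN1r; apply: integral_closureM => //;
   apply/integral_opp/integral_closure1.
Qed.

Lemma fieldNorm_integral (z : E) : S z -> V (fieldNorm z).
Proof.
move=> Sz; have SN : S (- z) by apply: integral_opp.
have [p [mon_p irr_p pE]] := minPoly_integral SN.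
have := fieldNorm_minPoly 0 pE; rewrite scale0r sub0r opprK => ->.
rewrite -(rmorph0 iota) horner_map.
by eexists; rewrite -rmorphXn.
Qed.

Lemma valring_sqrt_1pi r :
  exists s, [/\ iota s != 0 & iota (1 + pi * r) = iota s ^+ 2].
Proof.
have [s [q E1]] := sqrt_1pi_mod_monic dvrR unif r%:P cR two_unit (monicX R).
have := congr1 (horner^~ 0) E1.
rewrite !hornerE /= ?mulr0 => /eqP; rewrite subr_eq0 => /eqP E2.
exists (1 + pi * s.[0]); rewrite -E2 rmorphXn; split=> //.
rewrite (iota_eq0 fracF); apply: contraTneq (unitr1 R) => s0.
rewrite -(addrK (pi * s.[0]) 1) s0 sub0r unitrN mulrC.
by apply: nonunitMl => //; apply: uniformizer_nonunit.
Qed.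

(** As [1 + pi z] is [- pi] times [- 1 / pi - z], its norm is a power of [- pi]
    times a power of the value at [- 1 / pi] of the minimal polynomial of [z];
    the power of [- pi] clears the denominators and leaves the leading
    coefficient as the constant term. *)
Lemma fieldNorm_1pi (z : E) : S z ->
  exists r, fieldNorm (1 + (iota pi)%:A * z) = iota (1 + pi * r).
Proof.
move=> Sz; have [p [mon_p irr_p pE]] := minPoly_integral Sz.
have pi0 : iota pi != 0.
  by rewrite (iota_eq0 fracF) (uniformizer_neq0 dvrR unif).
set m := (\dim_(<<1; z>>) {:E})%N.
pose d := (size p).-1.
have dimE : (\dim {:E} = d * m)%N.
  rewrite (dim_sup_field (subvf <<1; z>>)) mulnC; congr (_ * _)%N.
  rewrite dim_Fadjoin dimv1 muln1 /d.
  have := size_minPoly 1 z; rewrite pE size_map_poly.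
  by rewrite size_map_poly_id0 ?(monicP mon_p) ?rmorph1 ?oner_neq0 // => ->.
have -> : 1 + (iota pi)%:A * z
    = (- iota pi)%:A * ((- (iota pi)^-1)%:A - z) :> E.
  rewrite mulrBr -!in_algE -rmorphM mulrNN divff // rmorph1 rmorphN.
  by rewrite mulNr opprK.
rewrite fieldNormM fieldNorm_alg (fieldNorm_minPoly _ pE) -/m dimE exprM
  -exprMn.
have [r ->] : exists r, (- iota pi) ^+ d * (map_poly iota p).[- (iota pi)^-1]
    = iota (1 + pi * r).
  rewrite (@horner_coef_wide _ d.+1); last first.
    by rewrite size_map_poly_id0 ?(monicP mon_p) ?rmorph1 ?oner_neq0 ?leqSpred.
  rewrite big_ord_recr /= mulrDr coef_map /= [p`_d](monicP mon_p) rmorph1 mul1r.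
  rewrite -exprMn mulrNN divff // expr1n.
  exists (\sum_(i < d) - (p`_i * (- pi) ^+ (d - i).-1)).
  rewrite rmorphD rmorph1 addrC; congr (_ + _).
  rewrite rmorphM rmorph_sum !mulr_sumr; apply: eq_bigr => i _.
  have inv1 : (- iota pi) ^+ i * (- (iota pi)^-1) ^+ i = 1.
    by rewrite -exprMn mulrNN divff // expr1n.
  have di : (0 < d - i)%N by rewrite subn_gt0.
  rewrite coef_map /= -{1}(subnK (ltnW (ltn_ord i))) exprD mulrCA -!mulrA inv1.
  rewrite mulr1 -{1}(prednK di) exprS rmorphN rmorphM rmorphXn rmorphN; ring.
elim: (m) => [|k [s IHk]].
  by exists 0; rewrite expr0 mulr0 addr0 rmorph1.
by exists (r + s + pi * r * s); rewrite exprS IHk -rmorphM; congr (iota _);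
  ring.
Qed.

End IntegralClosure.

(** * Springer's theorem and the norm principle for diagonal forms *)

Definition dform (A : nzRingType) (I : finType) (c v : I -> A) : A :=
  \sum_i c i * v i ^+ 2.

Lemma rmorph_dform (A A' : nzRingType) (f : {rmorphism A -> A'}) (I : finType)
    (c v : I -> A) : f (dform c v) = dform (f \o c) (f \o v).
Proof.
by rewrite rmorph_sum; apply: eq_bigr => i _; rewrite rmorphM rmorphXn.
Qed.

Lemma dformZ (A : comNzRingType) (I : finType) (c v : I -> A) a :
  dform c (fun i => a * v i) = a ^+ 2 * dform c v.
Proof. by rewrite mulr_sumr; apply: eq_bigr => i _; rewrite exprMn mulrCA. Qed.

(** When [w] is isotropic this depends linearly on [a], so that a form with a
    suitable isotropic vector is universal if [2] is invertible. *)
Lemma dform_axis (A : comNzRingType) (I : finType) (c w : I -> A) a j :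
  dform c (fun i => a * w i + (i == j)%:R)
    = a ^+ 2 * dform c w + 2%:R * a * (w j * c j) + c j.
Proof.
rewrite /dform (bigD1 j) //= [in RHS](bigD1 j) //= eqxx /=.
rewrite (eq_bigr (fun i => a ^+ 2 * (c i * w i ^+ 2))) => [|i /negPf->].
  by rewrite -mulr_sumr; ring.
by rewrite addr0 exprMn mulrCA.
Qed.

Section Anisotropic.

Variables (K : fieldType) (I : finType) (c : I -> K).

Definition anisotropic := forall v, dform c v = 0 -> forall i, v i = 0.

Definition represents (d : K) := d != 0 /\ exists v, d = dform c v.

(** The subgroup of the multiplicative group generated by the nonzero values of
    the form and the nonzero squares. *)
Definition value_group : set K :=
  [set y | exists (a : K) (ds : seq K), [/\ a != 0,
     forall d, d \in ds -> represents d & y = a ^+ 2 * \prod_(d <- ds) d]].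

Lemma value_group_square a : a != 0 -> value_group (a ^+ 2).
Proof. by exists a, [::]; rewrite big_nil mulr1. Qed.

Lemma value_group_represents d : represents d -> value_group d.
Proof.
exists 1, [:: d]; rewrite oner_neq0 big_seq1 expr1n mul1r; split=> // e.
by rewrite inE => /eqP->.
Qed.

Lemma value_groupM x y :
  value_group x -> value_group y -> value_group (x * y).
Proof.
move=> [a [ds [a0 dsP ->]]] [b [es [b0 esP ->]]].
exists (a * b), (ds ++ es); rewrite mulf_neq0 // big_cat /=; split=> // [d|].
  by rewrite mem_cat => /orP[/dsP | /esP].
by rewrite exprMn mulrACA.
Qed.

Lemma value_group_neq0 x : value_group x -> x != 0.
Proof.
move=> [a [ds [a0 dsP ->]]]; rewrite mulf_neq0 ?expf_neq0 // prodf_seq_neq0.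
by apply/allP=> d /dsP[].
Qed.

Lemma value_groupV x : value_group x -> value_group x^-1.
Proof.
move=> Px; have x0 := value_group_neq0 Px.
have -> : x^-1 = x * (x^-1) ^+ 2 by field.
by apply: value_groupM => //; apply: value_group_square; rewrite invr_neq0.
Qed.

Lemma value_groupX x k : value_group x -> value_group (x ^+ k).
Proof.
move=> Px; elim: k => [|k IHk]; last by rewrite exprS; apply: value_groupM.
by rewrite expr0 -(expr1n _ 2); apply/value_group_square/oner_neq0.
Qed.

Let cP (i : I) : {poly K} := (c i)%:P.

Hypothesis anis : anisotropic.

Lemma anisotropic_coef i : c i != 0.
Proof.
apply/eqP=> ci0; have /anis/(_ i)/eqP : dform c (fun j => (j == i)%:R) = 0.
  apply: big1 => j _; case: eqVneq => [->|_]; last by rewrite expr0n mulr0.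
  by rewrite ci0 mul0r.
by rewrite eqxx oner_eq0.
Qed.

(** Since the vector of leading coefficients is not isotropic, leading terms
    cannot cancel. *)
Lemma dform_poly_lead (v : I -> {poly K}) : (exists i, v i != 0) ->
  exists D, [/\ forall i, (size (v i) <= D.+1)%N, exists i, size (v i) = D.+1,
    size (dform cP v) = D.*2.+1 & represents (lead_coef (dform cP v))].
Proof.
move=> [i0 vi0]; pose m := \max_i size (v i).
have [|i1 mE] := @eq_bigmax I (fun i => size (v i)).
  by apply/card_gt0P; exists i0.
have lem i : (size (v i) <= m)%N by apply: leq_bigmax.
have m_gt0 : (0 < m)%N by apply: leq_trans (lem i0); rewrite size_poly_gt0.
pose D := m.-1; have mD : m = D.+1 by rewrite prednK.
have szv i : (size (v i) <= D.+1)%N by rewrite -mD.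
pose w i := (v i)`_D.
have coefE : (dform cP v)`_(D.*2) = dform c w.
  rewrite coef_sum; apply: eq_bigr => i _; rewrite coefCM; congr (_ * _).
  have ltD : (D < (D + D).+1)%N by rewrite ltnS leq_addr.
  rewrite -addnn expr2 coefM (bigD1 (Ordinal ltD)) //= addnK big1 ?addr0 //.
  move=> k; rewrite -val_eqE /= neq_ltn => /orP[kD | Dk].
    rewrite [X in _ * X]nth_default ?mulr0 // (leq_trans (szv i)) //.
    by rewrite ltn_subRL ltn_add2r.
  by rewrite nth_default ?mul0r // (leq_trans (szv i)).
have w0 : dform c w != 0.
  apply/eqP => /anis/(_ i1); rewrite /w /D /m mE -lead_coefE => /eqP.
  by rewrite lead_coef_eq0 -size_poly_eq0 -mE -/m mD.
have szf : (size (dform cP v) <= D.*2.+1)%N.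
  apply: (leq_trans (size_sum _ _ _)); apply/bigmax_leqP => i _.
  rewrite mul_polyC (leq_trans (size_scale_leq _ _)) // expr2.
  rewrite (leq_trans (size_polyMleq _ _)) //.
  have := szv i; case: (size _) => [|k] //; rewrite ltnS => kD.
  by rewrite addnS /= addSn ltnS -addnn leq_add.
have sz : size (dform cP v) = D.*2.+1.
  apply/eqP; rewrite eqn_leq szf /= ltnNge; apply: contra w0 => le.
  by rewrite -coefE nth_default.
exists D; split=> //; first by exists i1; rewrite -mE -/m.
by rewrite lead_coefE sz /= coefE; split=> //; exists w.
Qed.

Lemma dform_modp (v : I -> {poly K}) h :
  h %| dform cP v - dform cP (fun i => v i %% h).
Proof.
rewrite /dform -sumrB; elim/big_ind: _ => [|? ? ? ?|i _]; first exact: dvdp0.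
  exact: dvdp_add.
rewrite -mulrBr subr_sqr; apply/dvdp_mull/dvdp_mulr.
by rewrite {1}(divp_eq (v i) h) addrK dvdp_mulIr.
Qed.

(** A family of polynomials divided by a common divisor of greatest degree. *)
Lemma primitive_part (v : I -> {poly K}) : (exists i, v i != 0) ->
  exists e (w : I -> {poly K}), [/\ e != 0, forall i, v i = e * w i
    & forall q, (forall i, q %| w i) -> q %= 1].
Proof.
move=> [i0 vi0].
pose P s := `[< exists e : {poly K}, size e = s /\ forall i, e %| v i >].
have exP : exists s, P s.
  by exists (size (1 : {poly K})); apply/asboolP; exists 1; split=> // i;
    rewrite dvd1p.
have leP s : P s -> (s <= size (v i0))%N.
  by move=> /asboolP[e [<- ev]]; apply: dvdp_leq.
case: (ex_maxnP exP leP) => s /asboolP[e [se ev]] maxs.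
have e0 : e != 0 by apply: contraNneq vi0 => e0; rewrite -dvd0p -e0.
exists e, (fun i => v i %/ e); split=> // [i | q qw].
  by rewrite mulrC divpK.
have q0 : q != 0.
  apply: contraNneq vi0 => q0; have := qw i0; rewrite q0 dvd0p => /eqP w0.
  by rewrite -(divpK (ev i0)) w0 mul0r.
have : P (size (q * e)).
  apply/asboolP; exists (q * e); split=> // i.
  by rewrite -[v i](divpK (ev i)) dvdp_mul2r.
move/maxs; rewrite -se size_mul // -size_poly_eq1 eqn_leq size_poly_gt0 q0
  andbT.
have := size_poly_gt0 e; rewrite e0; case: (size e) => // k _.
by rewrite addnS /= -[X in (_ <= X)%N]add1n leq_add2r.
Qed.

(** Springer's theorem, for a polynomial instead of an extension: dividing a
    relation [dform v = h * g] by [h] of odd degree leaves a cofactor [g] of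
    smaller odd degree. *)
Lemma springer_poly (h : {poly K}) (v : I -> {poly K}) :
    odd (size h).-1 -> h %| dform cP v ->
    (forall q, q %| h -> (forall i, q %| v i) -> q %= 1) -> False.
Proof.
have [s] := ubnP (size h); elim: s h v => // s IHs h v le_hs odd_h h_dvd cop.
have h0 : h != 0 by apply: contraTneq odd_h => ->; rewrite size_poly0.
pose v1 i := v i %% h.
have h_dvd1 : h %| dform cP v1.
  by rewrite -(dvdp_subr _ h_dvd) dform_modp.
have cop1 q : q %| h -> (forall i, q %| v1 i) -> q %= 1.
  by move=> qh qv; apply: cop => // i; rewrite (dvdp_mod _ qh) qv.
have nz1 : exists i, v1 i != 0.
  apply: contrapT => no; have hv i : h %| v1 i.
    by have [->|vi] := eqVneq (v1 i) 0; rewrite ?dvdp0 //; case: no; exists i.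
  have := cop1 h (dvdpp h) hv; rewrite -size_poly_eq1 => /eqP h1.
  by rewrite h1 in odd_h.
have [e [w [e0 vE prim]]] := primitive_part nz1.
have nzw : exists i, w i != 0.
  by case: nz1 => i; rewrite vE mulf_eq0 => /norP[_ wi]; exists i.
have [D [szw [i1 szi1] szf _]] := dform_poly_lead nzw.
have D_lt : (D.+1 < size h)%N.
  rewrite -szi1 (leq_ltn_trans (_ : _ <= size (v1 i1))%N) ?ltn_modp //.
  rewrite vE; apply: dvdp_leq; last exact: dvdp_mulIr.
  by rewrite mulf_neq0 // -size_poly_eq0 szi1.
have h_dvd2 : h %| dform cP w.
  have E : dform cP v1 = e ^+ 2 * dform cP w.
    by rewrite -dformZ; apply: eq_bigr => i _; rewrite vE.
  move: h_dvd1; rewrite E Gauss_dvdpr // coprimep_pexpr //.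
  apply/coprimepP => q qh qe; apply: cop1 => // i.
  by rewrite vE dvdp_mulr.
have /dvdpP[g gE] := h_dvd2.
have f0 : dform cP w != 0 by rewrite -size_poly_eq0 szf.
have g0 : g != 0 by apply: contraNneq f0 => g0; rewrite gE g0 mul0r.
have szg : ((size g).-1 + (size h).-1 = D.*2)%N.
  move: szf; rewrite gE size_mul //.
  have := size_poly_gt0 g; have := size_poly_gt0 h; rewrite g0 h0.
  by case: (size g) (size h) => [|k] [|l] // _ _; rewrite addnS addSn => -[].
apply: (IHs g w).
- rewrite (leq_trans _ (le_hs : (size h <= s)%N)) //.
  have := D_lt; have := szg; have := size_poly_gt0 g; rewrite g0.
  case: (size g) (size h) => [|k] [|l] //= _ E; rewrite !ltnS => Dl.
  by rewrite -(ltn_add2r l) E -addnn -addSn leq_add // ltnW.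
- have := congr1 odd szg; rewrite oddD odd_h odd_double.
  by case: (odd _).
- by rewrite gE dvdp_mulIl.
by move=> q _; apply: prim.
Qed.

End Anisotropic.

Section NormPrinciple.

Variables (K : fieldType) (I : finType) (c : I -> K).
Hypothesis anis : anisotropic c.

Local Notation cP := (fun i => (c i)%:P).

Lemma horner_dform (v : I -> {poly K}) a :
  (dform cP v).[a] = dform c (fun i => (v i).[a]).
Proof.
by rewrite horner_sum; apply: eq_bigr => i _;
  rewrite hornerM hornerC horner_exp.
Qed.

(** Knebusch's norm principle for [t] modulo [h], where up to sign
    [h.[0] / lead_coef h] is the norm of [t].  Write [dform v = t + h * g] with
    [v] reduced modulo [h], so that [g] has smaller degree than [h].  Unless [v]
    is constant or [g] vanishes at [0], the constant and the leading coefficient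
    of [h * g] are both values of the form, so that the norms of [t] modulo [h]
    and modulo [g] agree in the quotient by [value_group c]. *)
Lemma norm_principle_poly (h : {poly K}) (v : I -> {poly K}) :
    h.[0] != 0 -> h %| dform cP v - 'X ->
  value_group c ((-1) ^+ (size h).-1 * (h.[0] * lead_coef h)).
Proof.
have [s] := ubnP (size h); elim: s h v => // s IHs h v le_hs h00 h_dvd.
have h0 : h != 0 by apply: contraNneq h00 => ->; rewrite horner0.
have [/eqP/size_poly1P[a a0 hE]|szh] := eqVneq (size h) 1%N.
  rewrite hE lead_coefC hornerC size_polyC a0 expr0 mul1r -expr2.
  exact: value_group_square.
have szh1 : (1 < size h)%N by rewrite ltn_neqAle eq_sym szh size_poly_gt0.
pose v1 i := v i %% h; pose f := dform cP v1.
have /dvdpP[g gE] : h %| f - 'X.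
  have := dvdp_sub h_dvd (dform_modp c v h); rewrite -/v1 -/f.
  by congr (_ %| _); ring.
have hN1 k : h * k != -1.
  apply: contraTneq szh1 => hk; rewrite -leqNgt.
  have : size (h * k) = 1%N by rewrite hk size_polyN size_poly1.
  have k0 : k != 0.
    by apply: contra_eq_neq hk => ->; rewrite mulr0 eq_sym oppr_eq0 oner_eq0.
  rewrite size_mul //; have := size_poly_gt0 k; rewrite k0.
  by case: (size k) => // k' _; rewrite addnS /= => <-; rewrite leq_addr.
have nz1 : exists i, v1 i != 0.
  apply: contrapT => no.
  have f0 : f = 0.
    apply: big1 => i _; have [->|vi] := eqVneq (v1 i) 0.
      by rewrite expr0n mulr0.
    by case: no; exists i.
  have : g.[0] = 0.
    have /eqP := congr1 (horner^~ 0) gE.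
    rewrite f0 !hornerE /= oppr0 eq_sym mulf_eq0 (negPf h00) orbF.
    by move/eqP.
  move=> /rootP/factor_theorem[k kE]; have /eqP := hN1 k; apply.
  apply: (mulIf (negbT (polyX_eq0 K))).
  by rewrite mulN1r -[- 'X]add0r -f0 gE kE subr0; ring.
have [D [szv [i1 szi1] szf [lf0 lfv]]] := dform_poly_lead anis nz1.
rewrite -/f in szf lf0 lfv.
have D_lt : (D.+1 < size h)%N by rewrite -szi1 ltn_modp.
have f00E : f.[0] = dform c (fun i => (v1 i).[0]) by apply: horner_dform.
have hg0 : f.[0] = g.[0] * h.[0].
  by have := congr1 (horner^~ 0) gE;
    rewrite hornerM hornerD hornerN hornerX subr0.
have g0 : g != 0.
  apply: contraTneq lf0 => g0; move: gE; rewrite g0 mul0r => /eqP.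
  rewrite subr_eq0 => /eqP fX; move: szf; rewrite fX size_polyX.
  by move/(congr1 odd); rewrite /= odd_double.
have sz_gh : (size (g * h)).-1 = ((size g).-1 + (size h).-1)%N.
  rewrite size_mul //; have := size_poly_gt0 g; have := size_poly_gt0 h.
  by rewrite g0 h0; case: (size g) (size h) => [|k] [|l] //;
    rewrite addnS addSn.
(* If [v1] is constant, then [h] has degree one and [g] is constant. *)
case: D szv szi1 szf D_lt => [|D] szv szi1 szf D_lt.
  have fC : f = (f.[0])%:P.
    by have /size_poly1P[a _ ->] : size f == 1%N; rewrite ?szf ?hornerC.
  have gh : g * h = - 'X + (f.[0])%:P by rewrite -gE {1}fC addrC.
  have : (size (g * h)).-1 = 1%N.
    by rewrite gh size_polyDl ?size_polyN ?size_polyX ?ltnS ?size_polyC_leq1.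
  rewrite sz_gh; case: (size h) szh1 => [|[|[|k]]] // _; last first.
    by rewrite addnS addnS.
  rewrite /= addn1 => -[sg].
  have gC : g = (g.[0])%:P.
    have /size_poly1P[a _ ->] : size g == 1%N; last by rewrite hornerC.
    by move: sg (size_poly_gt0 g); rewrite g0; case: (size g) => // k /= ->.
  have g00 : g.[0] != 0 by rewrite -polyC_eq0 -gC.
  have lead_gh : g.[0] * lead_coef h = -1.
    rewrite -lead_coefZ -mul_polyC -gC gh lead_coefDl ?lead_coefN ?lead_coefX
      //.
    by rewrite size_polyN size_polyX ltnS size_polyC_leq1.
  have -> : (-1) ^+ 1 * (h.[0] * lead_coef h) = f.[0] * (g.[0]^-1) ^+ 2.
    have -> : lead_coef h = - g.[0]^-1.
      by apply: (mulfI g00); rewrite lead_gh mulrN divff.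
    by rewrite hg0; field.
  apply: value_groupM; last by apply: value_group_square; rewrite invr_neq0.
  apply: value_group_represents; split; first by rewrite hg0 mulf_neq0.
  by rewrite f00E; eexists.
have lead_gh : lead_coef g * lead_coef h = lead_coef f.
  rewrite -lead_coefM -gE lead_coefDl // size_polyN size_polyX szf.
  by rewrite doubleS.
have sz2 : ((size g).-1 + (size h).-1 = D.+1.*2)%N.
  by rewrite -sz_gh -gE size_polyDl ?szf // size_polyN size_polyX.
have lg0 : lead_coef g != 0 by rewrite lead_coef_eq0.
have lh0 : lead_coef h != 0 by rewrite lead_coef_eq0.
have Plead : value_group c (lead_coef f).
  exact: value_group_represents.
have signE k l : ~~ odd (k + l) -> (-1) ^+ l = ((-1) ^+ k)^-1 :> K.
  rewrite oddD negb_add -signr_odd -[X in _ = X^-1]signr_odd => /eqP ->.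
  by case: (odd l); rewrite ?invrN1 ?invr1.
have even_gh : ~~ odd ((size g).-1 + (size h).-1) by rewrite sz2 odd_double.
have sz_g : (size g < size h)%N.
  have := sz2; have := size_poly_gt0 g; rewrite g0; move: D_lt.
  case: (size g) (size h) => [|k] [|l] //= Dl _ E; rewrite ltnS.
  by rewrite -(ltn_add2r l) E -addnn -addSn leq_add // ltnW.
have [g00|g00] := eqVneq g.[0] 0; last first.
  have Pg : value_group c ((-1) ^+ (size g).-1 * (g.[0] * lead_coef g)).
    apply: (IHs g v1) => //; first exact: leq_trans sz_g _.
    by rewrite -/f gE dvdp_mulIl.
  have -> : (-1) ^+ (size h).-1 * (h.[0] * lead_coef h) =
      f.[0] * lead_coef f * ((-1) ^+ (size g).-1 * (g.[0] * lead_coef g))^-1.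
    rewrite (signE _ _ even_gh) hg0 -lead_gh; field.
    by rewrite lg0 g00 signr_eq0.
  apply: value_groupM; last exact: value_groupV.
  apply: value_groupM => //; apply: value_group_represents.
  by split; [rewrite hg0 mulf_neq0 | rewrite f00E; eexists].
(* If [g] vanishes at [0], so does [v1] because the form is anisotropic, and
   the relation may be divided by [t]; the constant coefficient of the new
   relation is [-1]. *)
have v10 i : (v1 i).[0] = 0.
  move: i; apply: (anis (v := fun i => (v1 i).[0])).
  by rewrite -f00E hg0 g00 mul0r.
have /choice[w wE] i : exists w, v1 i = 'X * w.
  have /rootP/factor_theorem[w wE] := v10 i.
  by exists w; rewrite mulrC -[X in _ * X]subr0 -polyC0.
have /rootP/factor_theorem[g' g'E] := g00.
rewrite polyC0 subr0 in g'E.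
have fE : f = 'X ^+ 2 * dform cP w.
  by rewrite -dformZ; apply: eq_bigr => i _; rewrite wE.
have g'h : g' * h = 'X * dform cP w - 1.
  apply: (mulIf (negbT (polyX_eq0 K))); rewrite mulrAC -g'E -gE fE; ring.
have g'h0 : g'.[0] * h.[0] = -1.
  by have := congr1 (horner^~ 0) g'h; rewrite !hornerE /= ?mul0r ?sub0r ?add0r.
have g'0 : g' != 0 by apply: contraNneq g0 => g'0; rewrite g'E g'0 mul0r.
have g'00 : g'.[0] != 0.
  apply: contraTneq (oner_neq0 K) => g'00; move: g'h0.
  by rewrite g'00 mul0r => /eqP; rewrite eq_sym oppr_eq0 => ->.
have sz_g' : size g = (size g').+1 by rewrite g'E size_mulX.
have lg' : lead_coef g' = lead_coef g by rewrite g'E lead_coefMX.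
have Pg' : value_group c ((-1) ^+ (size g').-1 * (g'.[0] * lead_coef g')).
  apply: (IHs g' v1) => //.
    by rewrite -ltnS -sz_g' (leq_trans sz_g) // ltnW.
  by rewrite -/f gE g'E mulrAC -mulrA dvdp_mulIl.
have -> : (-1) ^+ (size h).-1 * (h.[0] * lead_coef h) =
    lead_coef f * ((-1) ^+ (size g').-1 * (g'.[0] * lead_coef g'))^-1.
  rewrite (signE _ _ even_gh) sz_g' /= -{1}[size g']prednK ?size_poly_gt0 //.
  rewrite exprS lg' -lead_gh.
  have -> : h.[0] = - g'.[0]^-1.
    by apply: (mulfI g'00); rewrite g'h0 mulrN divff.
  by field; rewrite lg0 g'00 signr_eq0 oppr_eq0 oner_eq0.
by apply: value_groupM => //; apply: value_groupV.
Qed.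

End NormPrinciple.

Section Springer.

Variables (F : fieldType) (E : fieldExtType F).

(** A zero over [L(al)] lifts to polynomials over [L] whose form is divisible by
    the minimal polynomial of [al]. *)
Lemma springer_simple (L : {subfield E}) (al : E) (I : finType) (c v : I -> E) :
    (forall i, c i \in L) -> (forall i, v i \in <<L; al>>%VS) ->
    odd (adjoin_degree L al) -> (exists i, v i != 0) -> dform c v = 0 ->
  exists w : I -> E,
    [/\ forall i, w i \in L, exists i, w i != 0 & dform c w = 0].
Proof.
move=> cL vL odd_d [i0 vi0] v_iso.
pose c' i : subvs_of L := Subvs (cL i).
have vsK (f : I -> subvs_of L) : dform c (fun i => vsval (f i))
    = vsval (dform c' f).
  by rewrite (rmorph_dform (vsval : {rmorphism _ -> _})).
have [p pE] : exists p : {poly subvs_of L}, minPoly L al = map_poly vsval p.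
  by have /polyOver_subvs[p ->] := minPolyOver L al; exists p.
have /choice[q qE] i : exists q : {poly subvs_of L},
    v i = (map_poly vsval q).[al].
  have /Fadjoin_polyP[f /polyOver_subvs[q ->] ->] := vL i; by exists q.
have pdvd (f : {poly subvs_of L}) : (map_poly vsval f).[al] = 0 -> p %| f.
  move=> f0; rewrite -(dvdp_map (vsval : {rmorphism subvs_of L -> E})) -pE.
  by apply: minPoly_dvdp; [apply/polyOver_subvs; exists f | apply/rootP].
apply: contrapT => no; apply: (@springer_poly (subvs_of L) I c' _ p q).
- move=> w w0 i; apply: contrapT => /eqP wi; apply: no.
  exists (fun i => vsval (w i)); split=> [j||]; first exact: subvsP.
    by exists i; apply: contraNneq wi => wi; apply/eqP/val_inj.
  by rewrite vsK w0.
- by rewrite -(size_map_poly (vsval : {rmorphism subvs_of L -> E})) -pE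
  size_minPoly.
- apply: pdvd; rewrite -v_iso (rmorph_dform (map_poly vsval)) /dform horner_sum.
  apply: eq_bigr => i _; rewrite hornerM horner_exp /= map_polyC hornerC /=.
  by rewrite -qE.
move=> r rp rq; have := minPoly_irr (p := map_poly vsval r) (K := L) (x := al).
rewrite pE dvdp_map rp => /(_ _ isT)/orP[|r_p|].
- by apply/polyOver_subvs; exists r.
- case/eqP: vi0; rewrite qE; move: r_p; rewrite eqp_map => r_p.
  have /dvdpP[k ->] : p %| q i0 by rewrite -(eqp_dvdl _ r_p).
  by rewrite rmorphM hornerM /= -pE minPolyxx mulr0.
by rewrite -!size_poly_eq1 size_map_poly.
Qed.

(** Springer's theorem: an extension of odd degree is reached through simple
    extensions, all of odd degree. *)
Lemma springer_subfield (L M : {subfield E}) (I : finType) (c v : I -> E) :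
    (L <= M)%VS -> odd (\dim_L M) ->
    (forall i, c i \in L) -> (forall i, v i \in M) ->
    (exists i, v i != 0) -> dform c v = 0 ->
  exists w : I -> E,
    [/\ forall i, w i \in L, exists i, w i != 0 & dform c w = 0].
Proof.
have [k] := ubnP (\dim_L M); elim: k L => // k IHk L le_k LM odd_d cL vM nz iso.
have [ML | /subvPn[al alM alL]] := boolP (M <= L)%VS.
  by exists v; split=> // i; apply: (subvP ML).
have L1M : (<<L; al>> <= M)%VS by apply/FadjoinP.
have dimE : (\dim_L M = \dim_<<L; al>> M * adjoin_degree L al)%N.
  rewrite adjoin_degreeE; apply/eqP.
  rewrite -(eqn_pmul2r (adim_gt0 L)) -mulnA -!dim_sup_field ?subv_adjoin //.
have adj_gt1 : (1 < adjoin_degree L al)%N.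
  rewrite ltn_neqAle eq_sym adjoin_deg_eq1 alL adjoin_degreeE.
  by rewrite divn_gt0 ?adim_gt0 // dimvS ?subv_adjoin.
have dim_gt0 : (0 < \dim_<<L; al>> M)%N by rewrite divn_gt0 ?adim_gt0 // dimvS.
move: odd_d; rewrite dimE oddM => /andP[odd1 odd2].
have [|i|w [wL1 nzw w_iso]] := IHk <<L; al>>%AS _ L1M odd1 _ vM nz iso.
- by rewrite -ltnS (leq_trans _ le_k) // dimE ltnS -[X in (X < _)%N]muln1
  ltn_pmul2l.
- by apply: (subvP (subv_adjoin _ _)).
exact: springer_simple cL wL1 odd2 nzw w_iso.
Qed.

End Springer.
Section FieldNormPrinciple.

Variables (F : fieldType) (E : fieldExtType F) (I : finType) (c : I -> F).
Hypotheses (two_neq0 : (2%:R : F) != 0) (anis : anisotropic c).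

Local Notation cE := (fun i => (c i)%:A : E).

(** Apply Springer's theorem to the form in one more variable obtained by
    subtracting [x] times a square.  A zero over [L] with nonzero last
    coordinate represents [x]; any other zero makes the form isotropic over
    [L], hence universal. *)
Lemma represents_odd (L : {subfield E}) (u : I -> E) :
    odd (\dim_L {:E}) -> dform cE u \in L ->
  exists u' : I -> E, (forall i, u' i \in L) /\ dform cE u' = dform cE u.
Proof.
move=> odd_m; set x := dform cE u => xL.
pose c' (o : option I) : E := if o is Some i then cE i else - x.
pose u1 (o : option I) : E := if o is Some i then u i else 1.
have c'E w : dform c' w = dform cE (w \o Some) - x * w None ^+ 2.
  rewrite /dform (bigD1 None) //= addrC mulNr; congr (_ - _).
  rewrite (reindex_omap Some id) => [|[]//]; apply: eq_bigl => i.
  by rewrite /= eqxx.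
have cL i : cE i \in L by rewrite rpredZ // rpred1.
have [||||w [wL [o wo] w_iso]] :=
  @springer_subfield F E L fullv _ c' u1 (subvf L) odd_m.
- by case=> [i|]; [exact: cL | rewrite rpredN].
- by move=> o; rewrite memvf.
- by exists None; rewrite oner_neq0.
- by rewrite c'E /= expr1n mulr1 subrr.
move: w_iso; rewrite c'E => /eqP; rewrite subr_eq0 => /eqP w_iso.
have [t0|t0] := eqVneq (w None) 0; last first.
  exists (fun i => (w None)^-1 * w (Some i)); split=> [i|].
    by rewrite rpredM ?rpredV.
  by rewrite dformZ [dform _ _]w_iso mulrCA -exprMn mulVf // expr1n mulr1.
move: w_iso; rewrite t0 expr0n mulr0 => w_iso.
case: o wo => [j wj|]; last by rewrite t0 eqxx.
have cj : cE j != 0 by rewrite scaler_eq0 oner_eq0 orbF anisotropic_coef.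
have two0 : (2%:R : E) != 0 by rewrite -(rmorph_nat (in_alg E)) fmorph_eq0.
pose a := (x - cE j) / (2%:R * (w (Some j) * cE j)).
exists (fun i => a * w (Some i) + (i == j)%:R); split=> [i|].
  rewrite rpredD ?rpred_nat // rpredM // rpredM ?rpredB // rpredV.
  by rewrite rpredM ?rpred_nat // rpredM.
rewrite dform_axis [dform _ _]w_iso /a; field.
by rewrite two0 wj cj.
Qed.

(** If [E] has even degree over [F(x)], the norm of [x] is a square.  Otherwise
    [x] is a value of the form over [F(x)], that is [t] is a value modulo the
    minimal polynomial of [x]. *)
Theorem norm_principle (u : I -> E) : dform cE u != 0 ->
  value_group c (fieldNorm (dform cE u)).
Proof.
set x := dform cE u => x0.
have [p [pE mon_p irr_p]] := minPoly1E x.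
set m := (\dim_(<<1; x>>) {:E})%N.
pose d := (size p).-1.
have dE : adjoin_degree 1 x = d.
  by rewrite /d -(size_map_poly (in_alg E)) -pE size_minPoly.
have dimE : (\dim {:E} = d * m)%N.
  rewrite (dim_sup_field (subvf <<1; x>>)) mulnC; congr (_ * _)%N.
  by rewrite dim_Fadjoin dimv1 muln1 dE.
have NE : fieldNorm x = ((-1) ^+ d * p.[0]) ^+ m.
  have -> : x = (-1)%:A * (0%:A - x) by rewrite scale0r sub0r scaleN1r mulN1r
    opprK.
  rewrite fieldNormM fieldNorm_alg (fieldNorm_minPoly 0 pE) -/m dimE.
  by rewrite exprM exprMn.
have p00 : p.[0] != 0.
  have m_gt0 : (0 < m)%N by rewrite divn_gt0 ?adim_gt0 // dimvS ?subvf.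
  have := fieldNorm_neq0 x0; rewrite NE expf_eq0 m_gt0 /= mulf_eq0 negb_or.
  by case/andP.
have [odd_m | even_m] := boolP (odd m); last first.
  rewrite NE -(even_halfK even_m) -muln2 exprM; apply: value_group_square.
  by rewrite expf_neq0 // mulf_neq0 ?signr_eq0.
have [|u' [u'L u'x]] := @represents_odd <<1; x>>%AS u odd_m.
  exact: memv_adjoin.
have /choice[v vE] i : exists v : {poly F}, u' i = (map_poly (in_alg E) v).[x].
  exact/Fadjoin1_polyP.
rewrite NE; apply: value_groupX; rewrite -[p.[0]]mulr1 -{2}(monicP mon_p).
apply: (norm_principle_poly anis (v := v)) => //.
rewrite -(dvdp_map (in_alg E)) -pE minPoly_dvdp ?alg_polyOver // rootE.
rewrite rmorphB /= map_polyX !hornerE subr_eq0 -/x -[X in _ == X]u'x; apply/eqP.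
rewrite (rmorph_dform (map_poly (in_alg E))) /dform horner_sum.
by apply: eq_bigr => i _; rewrite hornerM horner_exp /= map_polyC hornerC vE.
Qed.

End FieldNormPrinciple.

(** * Diagonalisation of quadratic lattices *)

Section Diagonalisation.

Variables (R : idomainType) (pi : R).
Hypotheses (dvrR : dvr R) (unif : uniformizer pi).
Hypothesis two_unit : (2%:R : R) \is a GRing.unit.
Variables (F : fieldType) (iota : {rmorphism R -> F}).
Hypothesis fracF : is_fraction_field iota.

Local Notation V := (valring iota).

Definition divides_entries k l (d : F) (A : 'M[F]_(k, l)) :=
  forall i j, exists r, A i j = iota r * d.

Lemma divides_entriesMl k l m d (P : 'M[R]_(k, l)) (A : 'M[F]_(l, m)) :
  divides_entries d A -> divides_entries d (map_mx iota P *m A).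
Proof.
move=> dA i j; have /choice[r rE] := fun l => dA l j.
exists (\sum_l P i l * r l); rewrite mxE rmorph_sum mulr_suml.
by apply: eq_bigr => t _; rewrite mxE rE rmorphM mulrA.
Qed.

Lemma divides_entries_tr k l d (A : 'M[F]_(k, l)) :
  divides_entries d A -> divides_entries d A^T.
Proof. by move=> dA i j; rewrite mxE; apply: dA. Qed.

Lemma divides_entries_congr k l d (P : 'M[R]_(k, l)) (A : 'M[F]_l) :
  divides_entries d A ->
  divides_entries d (map_mx iota P *m A *m (map_mx iota P)^T).
Proof.
move=> dA; rewrite -[X in divides_entries d X]trmxK trmx_mul trmxK.
apply/divides_entries_tr/divides_entriesMl/divides_entries_tr.
exact: divides_entriesMl.
Qed.

(** If no diagonal entry divides all the others, an off-diagonal entry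
    [B(x, y)] does, and then [B(x + y, x + y)] does too, since [2] is a unit
    while [B(x, x)] and [B(y, y)] are proper multiples. *)
Lemma dvr_symmetric_pivot k (A : 'M[F]_k.+1) : A^T = A -> A != 0 ->
  exists P : 'M[R]_k.+1, P \in unitmx /\
    let A' := map_mx iota P *m A *m (map_mx iota P)^T in
    A' 0 0 != 0 /\ divides_entries (A' 0 0) A.
Proof.
move=> symA A0.
have [|[i j] [_ /= Aij0 Amin]] :=
  @valring_min _ _ dvrR unif _ _ fracF _ (enum {: 'I_k.+1 * 'I_k.+1}) (fun p
    => A p.1 p.2).
  apply: contraNT A0 => /hasPn noA; apply/eqP/matrixP=> i j; rewrite mxE.
  by have := noA (i, j); rewrite mem_enum negbK => /(_ isT)/eqP.
have dvdA : divides_entries (A i j) A.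
  move=> s t; have [|r rE] := Amin (s, t); first by rewrite mem_enum.
  by exists r; rewrite -rE divfK.
have dvd_trans d : V (A i j / d) -> d != 0 -> divides_entries d A.
  move=> [r rE] d0 s t; have [r' ->] := dvdA s t.
  by exists (r' * r); rewrite rmorphM -rE -mulrA divfK.
suff [P [PU [l [d0 dV]]]] : exists P : 'M[R]_k.+1, P \in unitmx /\
    exists l, let A' := map_mx iota P *m A *m (map_mx iota P)^T in
    A' l l != 0 /\ V (A i j / A' l l).
  exists (tperm_mx 0 l *m P); rewrite unitmx_mul PU unitmx_perm; split=> //=.
  set A' := (X in X 0 0); suff -> : A' 0 0 =
      (map_mx iota P *m A *m (map_mx iota P)^T) l l.
    by split=> //; apply: dvd_trans.
  rewrite /A' map_mxM map_tperm_mx trmx_mul tr_tperm_mx !mulmxA.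
  by rewrite -xcolE mxE tpermL -!mulmxA -xrowE mxE tpermL !mulmxA.
have [[i' [Aii AV]] | noii] :=
  pselect (exists i', A i' i' != 0 /\ V (A i j / A i' i')).
  exists 1%:M; rewrite unitmx1; split=> //; exists i'.
  by rewrite /= map_mx1 mul1mx trmx1 mulmx1.
have diagN l r : A l l = iota r * A i j -> r \isn't a GRing.unit.
  move=> rE; apply/negP => rU; apply: noii; exists l.
  have r0 : iota r != 0 by rewrite -unitfE rmorph_unit.
  rewrite rE mulf_neq0 //; split=> //; exists r^-1.
  by rewrite rmorphV // invfM mulrCA divff // mulr1.
have neq_ij : i != j.
  apply: contra_notN noii => /eqP eq_ij; exists i.
  by move: Aij0; rewrite -eq_ij => Aii0; rewrite divff //; split;
    last exact: valring1.
pose D : 'M[R]_k.+1 := delta_mx i j.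
have DE (B : 'M[F]_k.+1) t : (map_mx iota D *m B) i t = B j t.
  rewrite mxE (bigD1 j) //= big1 => [|l lj];
    rewrite !mxE ?eqxx ?(negPf lj) ?andbF.
    by rewrite rmorph1 mul1r addr0.
  by rewrite rmorph0 mul0r.
have DE' (B : 'M[F]_k.+1) t : (B *m (map_mx iota D)^T) t i = B t j.
  by rewrite -[B]trmxK -trmx_mul mxE DE !mxE.
exists (1%:M + D); split.
  have /mulmx1_unit[] // : (1%:M + D) *m (1%:M - D) = 1%:M.
  rewrite mulmxDl !mulmxBr !mul1mx !mulmx1 mul_delta_mx_0 1?eq_sym //.
  by rewrite subr0 subrK.
exists i; set A' := _ *m _ *m _.
have [[r rE] [s sE]] := (dvdA i i, dvdA j j).
have A'E : A' i i = iota (2%:R + (r + s)) * A i j.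
  have Aji : A j i = A i j by rewrite -[A in LHS]symA mxE.
  rewrite /A' map_mxD map_mx1 linearD /= trmx1 mulmxDr mulmx1 mulmxDl mul1mx.
  rewrite mxE DE' [(A + _) i i]mxE [(A + _) i j]mxE !DE.
  rewrite Aji rE sE !rmorphD rmorph1; ring.
have U : 2%:R + (r + s) \is a GRing.unit.
  by apply: unit_addN => //; apply: nonunitD => //;
    [apply: (diagN i) | apply: (diagN j)].
have u0 : iota (2%:R + (r + s)) != 0 by rewrite -unitfE rmorph_unit.
rewrite /= A'E mulf_neq0 //; split=> //; exists (2%:R + (r + s))^-1.
by rewrite rmorphV // invfM mulrCA divff // mulr1.
Qed.

(** Gaussian elimination of the first row and column. *)
Lemma dvr_clear_pivot k (A : 'M[F]_(1 + k)) (d := ulsubmx A 0 0) :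
    A^T = A -> d != 0 -> divides_entries d A ->
  exists (P : 'M[R]_(1 + k)) (D : 'M[F]_k), [/\ P \in unitmx, D^T = D,
    map_mx iota P *m A *m (map_mx iota P)^T = block_mx d%:M 0 0 D
    & divides_entries d D].
Proof.
move=> symA d0 dA.
have /choice[b bE] : forall j, exists r,
  A (lshift k 0) (rshift 1 j) = iota r * d.
  by move=> j; apply: dA.
pose b0 : 'rV[R]_k := \row_j b j; pose bF := map_mx iota b0.
pose D : 'M[F]_k := drsubmx A - d *: (bF^T *m bF).
pose P1 : 'M[R]_(1 + k) := block_mx 1%:M 0 (- b0^T) 1%:M.
have urA : ursubmx A = d *: bF.
  by apply/rowP=> j; rewrite !mxE mulrC -bE; congr (A _ _); apply: val_inj.
have AE : A = block_mx d%:M (d *: bF) (d *: bF^T) (D + d *: (bF^T *m bF)).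
  rewrite subrK -[LHS]submxK -mx11_scalar urA; congr block_mx.
  by rewrite -[A in LHS]symA -trmx_ursub urA linearZ.
have P1A : map_mx iota P1 *m A *m (map_mx iota P1)^T = block_mx d%:M 0 0 D.
  rewrite [A in LHS]AE /P1 map_block_mx !map_mx1 map_mx0 map_mxN -map_trmx -/bF.
  rewrite tr_block_mx !trmx1 trmx0 linearN /= trmxK !mulmx_block.
  rewrite !mul1mx !mul0mx !mulmx0 !mulmx1 !addr0 !mulmxN !mulNmx mul_mx_scalar.
  rewrite mul_scalar_mx !addNr mul0mx oppr0 add0r.
  by rewrite -scalemxAr addrC addrK.
exists P1, D; split=> //.
- by rewrite unitmxE det_lblock !det1 mulr1 unitr1.
- rewrite /D linearB linearZ /= trmx_mul trmxK; congr (_ - _).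
  by rewrite trmx_drsub symA.
move=> i j; have := divides_entries_congr P1 dA.
rewrite P1A => /(_ (rshift 1 i) (rshift 1 j)).
by rewrite block_mxEdr.
Qed.

(** Split off a pivot dividing all entries and clear its row and column; the
    divisibility by the pivot persists in everything that follows. *)
Theorem dvr_diagonalize k (A : 'M[F]_k) : A^T = A ->
  exists (P : 'M[R]_k) (a : 'rV[F]_k), [/\ P \in unitmx,
    map_mx iota P *m A *m (map_mx iota P)^T = diag_mx a
    & forall i j : 'I_k, (i <= j)%N -> exists r, a 0 j = iota r * a 0 i].
Proof.
elim: k A => [|k IHk] A symA.
  exists 1%:M, 0; split=> [||[]//]; first exact: unitmx1.
  by apply/matrixP=> -[].
have [->|A0] := eqVneq A 0.
  exists 1%:M, 0; rewrite unitmx1 mulmx0 mul0mx; split=> // [|i j _].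
    by apply/matrixP=> i j; rewrite !mxE mul0rn.
  by exists 0; rewrite !mxE mulr0.
have [P [PU [d0 dA]]] := dvr_symmetric_pivot symA A0.
have [A1 A1P] : exists A1 : 'M[F]_(1 + k),
    A1 = map_mx iota P *m A *m (map_mx iota P)^T by eexists.
move: d0 dA; rewrite /= -A1P => d0 dA.
have A1d : ulsubmx A1 0 0 = A1 0 0.
  by rewrite !mxE; congr (A1 _ _); apply: val_inj.
have dA1 : divides_entries (ulsubmx A1 0 0) A1.
  by rewrite A1d {2}A1P; apply: divides_entries_congr.
have symA1 : A1^T = A1 by rewrite A1P !trmx_mul trmxK symA mulmxA.
have [|P1 [D [P1U symD P1A dD]]] := dvr_clear_pivot symA1 _ dA1.
  by rewrite A1d.
set d := ulsubmx A1 0 0 in P1A dD.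
have [P2 [a2 [P2U P2D a2_chain]]] := IHk D symD.
pose P3 : 'M[R]_(1 + k) := block_mx 1%:M 0 0 P2.
have a2d j : exists r, a2 0 j = iota r * d.
  have [r rE] := divides_entries_congr P2 dD j j.
  by exists r; rewrite -rE P2D !mxE eqxx mulr1n.
have P3U : P3 \in unitmx by rewrite unitmxE det_lblock det1 mul1r -unitmxE.
have P3D : map_mx iota P3 *m block_mx d%:M 0 0 D *m (map_mx iota P3)^T
    = diag_mx (row_mx d%:M a2).
  rewrite /P3 map_block_mx map_mx1 !map_mx0 tr_block_mx !trmx0 trmx1.
  rewrite !mulmx_block !mul1mx !mul0mx !mulmx0 !mulmx1 !addr0 !add0r P2D.
  rewrite mul0mx diag_mx_row; congr block_mx.
  by apply/matrixP=> i j; rewrite !ord1 !mxE.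
have chain (i j : 'I_(1 + k)) : (i <= j)%N -> exists r,
    (row_mx d%:M a2) 0 j = iota r * (row_mx d%:M a2) 0 i.
  have [i0 ->|i0 ->] := split_ordP i; have [j0 ->|j0 ->] := split_ordP j => ij.
  - by rewrite !row_mxEl !ord1; exists 1; rewrite rmorph1 mul1r.
  - by rewrite row_mxEl row_mxEr ord1 mxE; apply: a2d.
  - by move: ij; rewrite /= ord1.
  by rewrite !row_mxEr; apply: a2_chain.
exists (P3 *m (P1 *m P)), (row_mx d%:M a2); split=> //.
- by rewrite !unitmx_mul PU P1U P3U.
- by rewrite -P3D -P1A A1P !map_mxM !trmx_mul !mulmxA.
Qed.

End Diagonalisation.

(** * Orthogonal groups of diagonal lattices *)

Section Kneser.

Variables (K : fieldType) (Sr : set K).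
Hypotheses (Sr1 : Sr 1) (SrM : forall x y, Sr x -> Sr y -> Sr (x * y))
  (SrB : forall x y, Sr x -> Sr y -> Sr (x - y)).
Variables (n k : nat) (G : 'M[K]_n) (e : 'I_k -> 'rV[K]_n).
Hypothesis symG : G^T = G.

Local Notation B := (bform G).
Local Notation Q := (qform G).

Hypothesis orth_e : forall i j, i != j -> B (e i) (e j) = 0.
Hypothesis chain_e : forall i j : 'I_k, (i <= j)%N ->
  exists2 r, Sr r & Q (e j) = r * Q (e i).

Definition lattice_span : set 'rV[K]_n :=
  [set x | exists2 c : 'I_k -> K, forall i, Sr (c i) & x = \sum_i c i *: e i].

(** What remains of the lattice once the [e i] with [i < j] are split off. *)
Definition tail_span (j : 'I_k) : set 'rV[K]_n :=
  [set x | exists2 c : 'I_k -> K, forall i, Sr (c i)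
    & x = \sum_(i < k | (j <= i)%N) c i *: e i].

(** The reflections in these vectors preserve the lattice: [Q (e j)] divides the
    inner products of [u] with the lattice, hence so does [Q u], which differs
    from it by a unit. *)
Definition admissible (j : 'I_k) (u : 'rV[K]_n) : Prop :=
  [/\ tail_span j u, Q (e j) != 0, Q u != 0, Sr (Q u / Q (e j))
    & Sr (Q (e j) / Q u)].

Lemma Sr0 : Sr 0.
Proof. by rewrite -(subrr 1); apply: SrB. Qed.

Lemma SrN x : Sr x -> Sr (- x).
Proof. by move=> Sx; rewrite -sub0r; apply: SrB => //; apply: Sr0. Qed.

Lemma SrD x y : Sr x -> Sr y -> Sr (x + y).
Proof. by move=> Sx Sy; rewrite -[y]opprK; apply/SrB/SrN. Qed.

Lemma Sr_nat m : Sr m%:R.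
Proof. by elim: m => [|m IHm]; [apply: Sr0 | rewrite -addn1 natrD;
  apply: SrD]. Qed.

Lemma Sr_sum (I : Type) (s : seq I) (P : pred I) (f : I -> K) :
  (forall i, P i -> Sr (f i)) -> Sr (\sum_(i <- s | P i) f i).
Proof. by move=> Sf; elim/big_ind: _ => //; [apply: Sr0 | apply: SrD]. Qed.

Lemma tail_spanE (j : 'I_k) x : tail_span j x -> exists c : 'I_k -> K,
  [/\ forall i, Sr (c i), forall i : 'I_k, (i < j)%N -> c i = 0
    & x = \sum_i c i *: e i].
Proof.
move=> [c Sc ->]; exists (fun i : 'I_k => if (j <= i)%N then c i else 0); split.
- by move=> i; case: ifP => // _; apply: Sr0.
- by move=> i ij; rewrite leqNgt ij.
by rewrite big_mkcond; apply: eq_bigr => i _; case: ifP; rewrite ?scale0r.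
Qed.

Lemma tail_span_sum (j : 'I_k) (c : 'I_k -> K) : (forall i, Sr (c i)) ->
  (forall i : 'I_k, (i < j)%N -> c i *: e i = 0) ->
  tail_span j (\sum_i c i *: e i).
Proof.
move=> Sc c0; exists c => //; rewrite [RHS]big_mkcond; apply: eq_bigr => i _.
by case: leqP => // /c0.
Qed.

Lemma tail_span_lattice j x : tail_span j x -> lattice_span x.
Proof. by move=> /tail_spanE[c [Sc _ ->]]; exists c. Qed.

Lemma tail_span_e (j l : 'I_k) : (j <= l)%N -> tail_span j (e l).
Proof.
move=> jl; have -> : e l = \sum_i (i == l)%:R *: e i.
  rewrite (bigD1 l) //= eqxx scale1r big1 ?addr0 // => i /negPf->.
  by rewrite scale0r.
apply: tail_span_sum => [i|i ij]; first exact: Sr_nat.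
by rewrite -val_eqE ltn_eqF ?scale0r // (leq_trans ij).
Qed.

Lemma tail_spanD j x y : tail_span j x -> tail_span j y -> tail_span j (x + y).
Proof.
move=> [c Sc ->] [d Sd ->]; exists (fun i => c i + d i).
  by move=> i; apply: SrD.
by rewrite -big_split; apply: eq_bigr => i _; rewrite scalerDl.
Qed.

Lemma tail_spanZ j a x : Sr a -> tail_span j x -> tail_span j (a *: x).
Proof.
move=> Sa [c Sc ->]; exists (fun i => a * c i); first by move=> i; apply: SrM.
by rewrite scaler_sumr; apply: eq_bigr => i _; rewrite scalerA.
Qed.

Lemma lattice_spanB x y :
  lattice_span x -> lattice_span y -> lattice_span (x - y).
Proof.
move=> [c Sc ->] [d Sd ->]; exists (fun i => c i - d i).
  by move=> i; apply: SrB.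
by rewrite -sumrB; apply: eq_bigr => i _; rewrite scalerBl.
Qed.

Lemma bform_sum_e (c : 'I_k -> K) j :
  B (\sum_i c i *: e i) (e j) = c j * Q (e j).
Proof.
rewrite bform_suml (bigD1 j) //= bformZl big1 ?addr0 // => i ij.
by rewrite bformZl orth_e ?mulr0.
Qed.

Lemma bform_tail_span j x u : lattice_span x -> tail_span j u ->
  exists2 r, Sr r & B x u = r * Q (e j).
Proof.
move=> [c Sc ->] [d Sd ->].
pose P r := exists2 r', Sr r' & r = r' * Q (e j).
suff : P (\sum_(i < k | (j <= i)%N) d i * (c i * Q (e i))).
  move=> [r Sr_r rE]; exists r => //; rewrite -rE (bform_sumr symG).
  by apply: eq_bigr => i _; rewrite (bformZr symG) bform_sum_e.
elim/big_ind: _ => [|_ _ [a Sa ->] [b Sb ->]|i ji].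
- by exists 0; rewrite ?mul0r //; apply: Sr0.
- by exists (a + b); rewrite ?mulrDl //; apply: SrD.
have [r Sr_r ->] := chain_e ji; exists (d i * (c i * r));
  last by rewrite !mulrA.
by do 2?apply: SrM.
Qed.

Lemma reflection_lattice j u x : admissible j u -> lattice_span x ->
  lattice_span (reflection G u x).
Proof.
move=> [uj ej0 u0 _ Sju] Mx; have [r Sr_r rE] := bform_tail_span Mx uj.
apply: lattice_spanB => //; apply: (@tail_span_lattice j).
apply: tail_spanZ => //; rewrite rE -!mulrA; apply: SrM; first exact: Sr_nat.
exact: SrM.
Qed.

Lemma reflections_mx_Olat us :
  (forall u, u \in us -> exists j, admissible j u) ->
  Olat G lattice_span (reflections_mx G us).
Proof.
move=> adm; have Qus u : u \in us -> Q u != 0 by move=> /adm[j []].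
split; first exact: reflections_mx_Ogrp.
have latt vs x : (forall v, v \in vs -> exists j, admissible j v) ->
    lattice_span x -> lattice_span (foldr (reflection G) x vs).
  elim: vs => [|v vs IHvs] //= admv Mx.
  have [|j jv] := admv v; first exact: mem_head.
  apply: reflection_lattice jv _; apply: IHvs => // w wvs.
  by apply: admv; rewrite inE wvs orbT.
apply/seteqP; split=> [_ [x Mx <-]|x Mx].
  by rewrite mul_reflections_mx; apply: latt.
exists (foldr (reflection G) x (rev us)).
  by apply: latt => // u; rewrite mem_rev; apply: adm.
rewrite mul_reflections_mx -{2}[us]revK foldr_reflection_rev // => u.
by rewrite mem_rev => /Qus.
Qed.

Hypothesis two_neq0 : (2%:R : K) != 0.
Hypothesis Sr_half : Sr 2%:R^-1.
Hypothesis Sr_local : forall z, Sr z ->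
  (z != 0 /\ Sr z^-1) \/ (1 - z != 0 /\ Sr (1 - z)^-1).
Hypothesis anis_e : forall i, Q (e i) = 0 -> e i = 0.
Hypothesis span_e : forall x, exists c : 'I_k -> K, x = \sum_i c i *: e i.

Lemma reflection_sub x y : Q x = Q y -> Q (x - y) != 0 ->
  reflection G (x - y) y = x.
Proof.
move=> Qxy nz; rewrite /reflection; set t := _ / _; suff -> : t = -1.
  by rewrite scaleN1r opprK addrC subrK.
apply: (mulIf nz); rewrite divfK // mulN1r (qformB symG) -Qxy.
by rewrite (bformC symG) bformDl bformNl -/(Q y) -Qxy; ring.
Qed.

Lemma reflection_orth u x : B x u = 0 -> reflection G u x = x.
Proof. by move=> xu; rewrite /reflection xu mulr0 mul0r scale0r subr0. Qed.

(** Kneser's theorem.  An isometry fixing the [e i] with [i < j] moves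
    [x := e j] to some [y] with [Q y = Q x].  Since [Q (x - y) + Q (x + y)]
    is [4 Q x], one of [x - y] and [x + y] is admissible, the ring being local.
    The reflection in the former carries [y] to [x], and that in the latter
    carries [y] to [- x], which the reflection in [x] corrects. *)
Lemma kneser_generation (s : 'M[K]_n) :
    (forall x, Q (x *m s) = Q x) ->
    (forall x, lattice_span x -> lattice_span (x *m s)) ->
  exists us : seq 'rV[K]_n,
    (forall u, u \in us -> exists j, admissible j u) /\
    forall x, x *m s = foldr (reflection G) x us.
Proof.
suff gen m t : (forall x, Q (x *m t) = Q x) ->
    (forall x, lattice_span x -> lattice_span (x *m t)) ->
    (m <= k)%N -> (forall i : 'I_k, (i < k - m)%N -> e i *m t = e i) ->
    exists us : seq 'rV[K]_n, (forall u, u \in us -> exists j,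
      admissible j u) /\
    forall x, x *m t = foldr (reflection G) x us.
  move=> Qs Ms; apply: (gen k) => // i; by rewrite subnn.
elim: m t => [|m IHm] t Qt Mt le_mk fix_t.
  exists [::]; split=> // x /=; have [c ->] := span_e x.
  rewrite mulmx_suml; apply: eq_bigr => i _.
  by rewrite -scalemxAl fix_t // subn0.
have lt_mk : (k - m.+1 < k)%N by rewrite ltn_subrL (leq_trans _ le_mk).
pose j := Ordinal lt_mk; pose x := e j; pose y := x *m t.
have next t' : (forall x, Q (x *m t') = Q x) ->
    (forall x, lattice_span x -> lattice_span (x *m t')) ->
    (forall i : 'I_k, (i < j)%N -> e i *m t' = e i) -> x *m t' = x ->
    exists us : seq 'rV[K]_n, (forall u, u \in us -> exists j,
      admissible j u) /\
    forall x, x *m t' = foldr (reflection G) x us.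
  move=> Qt' Mt' fix_t' fix_x; apply: IHm => //; first exact: ltnW.
  move=> i; rewrite -(subnSK le_mk) ltnS leq_eqVlt.
  case/orP=> [/eqP ij|]; last exact: fix_t'.
  by have -> : i = j by apply: val_inj.
have [Qx0|Qx0] := eqVneq (Q x) 0.
  by apply: next => //; rewrite /x anis_e // mul0mx.
have My : lattice_span y by apply/Mt/(@tail_span_lattice j)/tail_span_e.
have yj : tail_span j y.
  have [c Sc yE] := My; rewrite yE; apply: tail_span_sum => // i ij.
  have : c i * Q (e i) = 0.
    rewrite -bform_sum_e -yE -(fix_t i ij) (isometry_bform symG) //.
    by rewrite orth_e // -val_eqE gtn_eqF.
  move/eqP; rewrite mulf_eq0 => /orP[/eqP->|/eqP/anis_e->].
    by rewrite scale0r.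
  by rewrite scaler0.
have Qy : Q y = Q x by apply: Qt.
have refl_next u : admissible j u -> (forall v, v \in [:: u] -> Q v != 0).
  by move=> [_ _ u0 _ _] v; rewrite inE => /eqP->.
have orth_u u (i : 'I_k) : tail_span j u -> (i < j)%N -> B (e i) u = 0.
  move=> [c Sc ->] ij; rewrite (bform_sumr symG) big1 // => l jl.
  rewrite (bformZr symG) orth_e ?mulr0 // -val_eqE.
  by rewrite ltn_eqF // (leq_trans ij).
have xj : tail_span j x by apply: tail_span_e.
have adm_x : admissible j x by split=> //; rewrite divff.
(* [ws] brings [y] back to [x] without moving the vectors already fixed. *)
suff [ws [ws_adm ws_y]] : exists ws : seq 'rV[K]_n,
    (forall u, u \in ws -> admissible j u) /\ foldr (reflection G) y ws = x.
  have Qws u : u \in ws -> Q u != 0 by move=> /ws_adm[].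
  have OL : Olat G lattice_span (reflections_mx G ws).
    by apply: reflections_mx_Olat => u /ws_adm; exists j.
  have [||i ij||us [us_adm usE]] := next (t *m reflections_mx G ws).
  - by move=> z; rewrite mulmxA (proj2 (proj1 OL)).
  - move=> z Mz; rewrite mulmxA.
    have [_ <-] := OL; exists (z *m t) => //; exact: Mt.
  - rewrite mulmxA fix_t // mul_reflections_mx.
    elim: (ws) ws_adm => //= u vs IHvs vs_adm.
    rewrite IHvs => [|v vvs]; last by apply: vs_adm; rewrite inE vvs orbT.
    by rewrite reflection_orth // orth_u //; case: (vs_adm u (mem_head _ _)).
  - by rewrite mulmxA mul_reflections_mx.
  exists (rev ws ++ us); split=> [u|z].
    rewrite mem_cat mem_rev => /orP[/ws_adm|/us_adm //]; by exists j.
  rewrite foldr_cat -usE mulmxA mul_reflections_mx.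
  by rewrite foldr_reflection_rev.
have SN1 : Sr (-1) by apply: SrN.
have adm_of u c : tail_span j u -> Q u = c * Q x -> c != 0 -> Sr c -> Sr c^-1 ->
    admissible j u.
  move=> uj uE c0 Sc ScV; rewrite /admissible -/x uE mulf_neq0 //.
  by rewrite mulfK // invfM mulrCA divff // mulr1.
have yNj : tail_span j (- y) by rewrite -scaleN1r; apply: tail_spanZ.
have mj : tail_span j (x - y) by apply: tail_spanD.
have pj : tail_span j (- x - y).
  by apply: tail_spanD => //; rewrite -scaleN1r; apply: tail_spanZ.
have [a Sa aE] := bform_tail_span (tail_span_lattice mj) mj.
have [b Sb bE] := bform_tail_span (tail_span_lattice pj) pj.
rewrite -/(Q _) -/x in aE; rewrite -/(Q _) -/x in bE.
pose h : K := 2%:R^-1; pose z := h * h * a.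
have ab : b = 4%:R - a.
  apply: (mulIf Qx0); rewrite -bE mulrBl -aE !(qformB symG) -!/(Q _) Qy.
  by rewrite bformNl /qform bformNl (bformNr symG) -/(Q x); ring.
have four0 : (4%:R : K) != 0 by rewrite (natrM _ 2 2) mulf_neq0.
have aZ : a = 4%:R * z by rewrite /z /h; field.
have bZ : b = 4%:R * (1 - z) by rewrite ab {1}aZ; ring.
have Sinv4 : Sr 4%:R^-1 by rewrite (natrM _ 2 2) invfM; apply: SrM.
have Qopp v : Q (- v) = Q v by rewrite -scaleN1r (qformZ symG) sqrrN expr1n
  mul1r.
have Sz : Sr z by apply: SrM => //; apply: SrM.
have [[z0 SzV]|[z0 SzV]] := Sr_local Sz.
  have a0 : a != 0 by rewrite aZ mulf_neq0.
  exists [:: x - y]; split=> [u|/=].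
    rewrite inE => /eqP->; apply: adm_of aE _ _ _ => //.
    by rewrite aZ invfM; apply: SrM.
  by apply: reflection_sub; rewrite ?Qy // aE mulf_neq0.
have b0 : b != 0 by rewrite bZ mulf_neq0.
exists [:: x; - x - y]; split=> [u|/=].
  rewrite !inE => /orP[/eqP->//|/eqP->]; apply: adm_of bE _ _ _ => //.
  by rewrite bZ invfM; apply: SrM.
rewrite reflection_sub ?Qopp ?Qy // ?bE ?mulf_neq0 //.
rewrite /reflection bformNl -/(Q x) mulrN mulNr mulfK // scaleNr opprK.
by rewrite scaler_nat mulr2n addKr.
Qed.

End Kneser.

(** * Diagonal bases of a lattice and of its extension *)

Section DiagonalLattice.

Variables (R : idomainType) (pi : R).
Hypotheses (dvrR : dvr R) (unif : uniformizer pi).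
Hypothesis two_unit : (2%:R : R) \is a GRing.unit.
Variables (F : fieldType) (iota : {rmorphism R -> F}).
Hypothesis fracF : is_fraction_field iota.

Local Notation V := (valring iota).

(** Some members of the family may vanish: a generating family is diagonalised
    without reducing it to a basis, and nondegeneracy turns the null diagonal
    entries into zero vectors. *)
Lemma diagonal_basis n (G : 'M[F]_n) (M : set 'rV[F]_n) :
    nondeg_symmetric G -> is_lattice iota M ->
  exists k (e : 'I_k -> 'rV[F]_n),
    [/\ forall i j, i != j -> bform G (e i) (e j) = 0,
        forall i j : 'I_k, (i <= j)%N ->
          exists2 r, V r & qform G (e j) = r * qform G (e i),
        forall i, qform G (e i) = 0 -> e i = 0,
        forall x, exists c : 'I_k -> F, x = \sum_i c i *: e i
      & M = lattice_span V e].
Proof.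
move=> [symG uG] [k [g [fullg ME]]].
have [|P [a [PU Pa chain]]] :=
  dvr_diagonalize dvrR unif two_unit fracF (A := g *m G *m g^T).
  by rewrite !trmx_mul trmxK symG mulmxA.
pose h := map_mx iota P *m g; pose e i := row i h.
have BE i j : bform G (e i) (e j) = diag_mx a i j.
  have -> : diag_mx a = h *m G *m h^T by rewrite -Pa /h trmx_mul !mulmxA.
  rewrite /bform /e -row_mul [LHS]mxE [RHS]mxE; apply: eq_bigr => l _.
  by congr (_ * _); rewrite !mxE.
have QE i : qform G (e i) = a 0 i by rewrite /qform BE !mxE eqxx mulr1n.
have orth i j : i != j -> bform G (e i) (e j) = 0.
  by move=> /negPf ij; rewrite BE !mxE ij.
have mulh (r : 'rV[F]_k) : r *m h = \sum_i r 0 i *: e i by apply: mulmx_sum_row.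
have PUF : map_mx iota P \in unitmx.
  have /mulmx1_unit[] // : map_mx iota P *m map_mx iota (invmx P) = 1%:M.
  by rewrite -map_mxM mulmxV ?map_mx1.
have fullh : row_full h.
  by rewrite /row_full /h (eqmxMfull _ _) ?row_full_unit.
have span_e x : exists c : 'I_k -> F, x = \sum_i c i *: e i.
  have /submxP[r ->] := submx_full x fullh.
  by exists (fun i => r 0 i); rewrite mulh.
exists k, e; split=> //.
- by move=> i j /chain[r rE]; exists (iota r); [exists r | rewrite !QE].
- move=> i Qi0; suff: e i *m G = 0.
    by move/(congr1 (mulmx^~ (invmx G))); rewrite mulmxK // mul0mx.
  apply/rowP=> l; rewrite [RHS]mxE.
  have [c cE] := span_e (delta_mx 0 l).
  have : bform G (e i) (delta_mx 0 l) = 0.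
    rewrite cE (bform_sumr symG) big1 // => j _; rewrite (bformZr symG).
    have [<-|ij] := eqVneq i j; last by rewrite orth // mulr0.
    by rewrite [bform _ _ _]Qi0 mulr0.
  by rewrite /bform trmx_delta -colE mxE.
rewrite ME; apply/seteqP; split=> [_ [r _ <-]|x [c Vc ->]].
  exists (fun i => iota ((r *m invmx P) 0 i)); first by move=> i; eexists.
  rewrite -{1}(mulmxKV PU r) map_mxM -mulmxA mulh.
  by apply: eq_bigr => i _; rewrite mxE.
have /choice[r rE] := Vc.
exists ((\row_i r i) *m P) => //; rewrite map_mxM -mulmxA mulh.
by apply: eq_bigr => i _; rewrite !mxE rE.
Qed.

End DiagonalLattice.

Section Extension.

Variables (R : idomainType) (F : fieldType) (iota : {rmorphism R -> F}).
Variable E : fieldExtType F.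

Local Notation S := (integral_closure iota E).
Local Notation V := (valring iota).

Variables (n k : nat) (G : 'M[F]_n) (e : 'I_k -> 'rV[F]_n).
Local Notation GE := (extend_mx E G).
Local Notation eE := (fun i => extend_mx E (e i)).

Lemma bform_extend (x y : 'rV[F]_n) :
  bform GE (extend_mx E x) (extend_mx E y) = (bform G x y)%:A.
Proof. by rewrite /bform /extend_mx map_trmx -!map_mxM mxE. Qed.

Lemma extend_mx_sum (c : 'I_k -> F) :
  extend_mx E (\sum_i c i *: e i) = \sum_i (c i)%:A *: extend_mx E (e i).
Proof.
rewrite /extend_mx raddf_sum; apply: eq_bigr => i _.
by rewrite /= map_mxZ.
Qed.

Lemma extend_span :
  (forall x, exists c : 'I_k -> F, x = \sum_i c i *: e i) ->
  forall y : 'rV[E]_n, exists c : 'I_k -> E, y = \sum_i c i *: eE i.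
Proof.
move=> span_e y.
have /choice[c cE] l := span_e (delta_mx 0 l).
exists (fun i => \sum_l y 0 l * (c l i)%:A).
rewrite {1}[y]row_sum_delta.
under [RHS]eq_bigr => i _ do rewrite scaler_suml.
rewrite exchange_big; apply: eq_bigr => l _ /=.
under [RHS]eq_bigr => i _ do rewrite -scalerA.
rewrite -scaler_sumr; congr (_ *: _).
by rewrite -extend_mx_sum -cE /extend_mx map_delta_mx.
Qed.

Lemma extend_lattice_span (M : set 'rV[F]_n) : M = lattice_span V e ->
  extend_lattice S M = lattice_span S eE.
Proof.
move=> ME; apply/seteqP; split=> [_ [m [c [x [Sc Mx ->]]]]|_ [c Sc ->]].
  have /choice[d dE] i : exists d : 'I_k -> F,
      (forall j, V (d j)) /\ x i = \sum_j d j *: e j.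
    by have := Mx i; rewrite ME => -[d Vd ->]; exists d.
  exists (fun j => \sum_i c i * (d i j)%:A).
    move=> j; apply: Sr_sum => [|x' y'|i _].
    - exact: (integral1 (in_alg E \o iota)).
    - exact: integral_closureB.
    apply: integral_closureM => //; apply: integral_closure_valring.
    by have [/(_ j)] := dE i.
  under [RHS]eq_bigr => i _ do rewrite scaler_suml.
  rewrite exchange_big; apply: eq_bigr => i _ /=.
  under [RHS]eq_bigr => j _ do rewrite -scalerA.
  by rewrite -scaler_sumr -extend_mx_sum; have [_ <-] := dE i.
exists k, c, e; split=> // i; rewrite ME.
have V1 := valring1 iota; have VB := @valringB _ _ iota.
by apply: (tail_span_lattice V1 VB (j := i)); apply: tail_span_e.
Qed.

End Extension.

(** * Norms of the values of admissible vectors *)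

Section AdmissibleNorm.

Variables (R : idomainType) (pi : R).
Hypotheses (dvrR : dvr R) (unif : uniformizer pi) (cR : complete R).
Hypothesis two_unit : (2%:R : R) \is a GRing.unit.
Variables (F : fieldType) (iota : {rmorphism R -> F}).
Hypothesis fracF : is_fraction_field iota.
Variable E : fieldExtType F.

Local Notation S := (integral_closure iota E).
Local Notation V := (valring iota).

Variables (n k : nat) (G : 'M[F]_n) (e : 'I_k -> 'rV[F]_n).
Hypothesis symG : G^T = G.
Hypothesis orth_e : forall i j, i != j -> bform G (e i) (e j) = 0.
Hypothesis chain_e : forall i j : 'I_k, (i <= j)%N ->
  exists2 r, V r & qform G (e j) = r * qform G (e i).

Local Notation GE := (extend_mx E G).
Local Notation eE := (fun i => extend_mx E (e i)).

Let V1 := valring1 iota.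
Let VM := @valringM _ _ iota.
Let VB := @valringB _ _ iota.

Lemma two_neq0_frac : (2%:R : F) != 0.
Proof. by rewrite -(rmorph_nat iota) -unitfE rmorph_unit. Qed.

Section Residual.

Variables (j : 'I_k) (r : 'I_k -> R).
Hypothesis aj0 : qform G (e j) != 0.
Hypothesis rE : forall i : 'I_k, (j <= i)%N ->
  qform G (e i) = iota (r i) * qform G (e j).

(** On these indices the values of the [e i], scaled by that of [e j],
  are units,
    so that they are the coefficients of a form that is regular modulo [pi]. *)
Local Notation J :=
  {i : 'I_k | (i : 'I_k)
    \in [pred i : 'I_k | (j <= i)%N && (r i \is a GRing.unit)]}.
Let rJ (s : J) : R := r (val s).
Let cJ (s : J) : F := iota (rJ s).

Lemma unit_part_admissible (w : J -> R) : dform rJ w \is a GRing.unit ->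
  exists2 y, admissible V G e j y
    & qform G y = iota (dform rJ w) * qform G (e j).
Proof.
move=> wU; pose y := \sum_s iota (w s) *: e (val s).
have wU0 : iota (dform rJ w) != 0 by rewrite -unitfE rmorph_unit.
have QyE : qform G y = iota (dform rJ w) * qform G (e j).
  rewrite [LHS]/qform {1}/y bform_suml rmorph_sum mulr_suml;
    apply: eq_bigr => s _.
  rewrite bformZl /y (bform_sumr symG) (bigD1 s) //= big1 ?addr0 => [|t ts].
    have /andP[js _] := valP s.
    rewrite (bformZr symG) [bform _ _ _]rE // rmorphM rmorphXn /rJ; ring.
  by rewrite (bformZr symG) orth_e ?mulr0 // (inj_eq val_inj) eq_sym.
exists y => //; split=> //.
- rewrite /y; elim/big_ind: _ => [||s _].
  + by rewrite -(scale0r (e j)); apply: (tail_spanZ VM);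
    [exact: Sr0 | apply: tail_span_e].
  + by move=> x z; apply: tail_spanD.
  apply: (tail_spanZ VM); first by eexists.
  by apply: tail_span_e => //; have /andP[] := valP s.
- by rewrite QyE mulf_neq0.
- by rewrite QyE mulfK //; eexists.
by rewrite QyE invfM mulrCA divff // mulr1 -rmorphV //; eexists.
Qed.

(** Modulo [pi] the form is isotropic, hence universal; a solution modulo [pi]
    is one up to squares, because [1 + pi R] consists of squares. *)
Lemma unit_part_isotropic (w : J -> R) s t :
    dform rJ w \isn't a GRing.unit -> w s \is a GRing.unit ->
    t \is a GRing.unit ->
  exists y a, [/\ admissible V G e j y, a != 0
    & iota t = a ^+ 2 * (qform G y * qform G (e j))].
Proof.
move=> wN wsU tU.
have rsU : rJ s \is a GRing.unit by have /andP[] := valP s.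
pose a := (t - rJ s) / (2%:R * (w s * rJ s)).
pose v i := a * w i + (i == s)%:R.
have [q qE] : exists q, dform rJ w = q * pi by apply/(nonunitP unif).
have vE : dform rJ v = t * (1 + pi * (a ^+ 2 * q / t)).
  have aE : 2%:R * a * (w s * rJ s) = t - rJ s.
    by rewrite [_ * a]mulrC -mulrA divrK // !unitrM two_unit wsU.
  rewrite dform_axis qE aE mulrDr mulr1 [t * (pi * _)]mulrCA [t * (_ / _)]mulrC.
  by rewrite divrK //; ring.
have [z [z0 zE]] := valring_sqrt_1pi dvrR unif cR two_unit fracF (a ^+ 2 * q /
  t).
have t0 : iota t != 0 by rewrite -unitfE rmorph_unit.
have [|y adm_y QyE] := @unit_part_admissible v.
  rewrite vE unitrM tU; apply: unit_addN => //; first exact: unitr1.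
  by rewrite mulrC; apply: nonunitMl => //; apply: uniformizer_nonunit.
exists y, (iota z * qform G (e j))^-1; split=> //.
  by rewrite invr_eq0 mulf_neq0.
rewrite QyE vE rmorphM zE; field.
by rewrite z0 aj0.
Qed.

(** Every nonzero vector is a multiple of a primitive one, and the form takes
    unit values on these; multiplied by the value of [e j] these are values of
    admissible vectors. *)
Lemma unit_part_anisotropic :
    (forall w, dform rJ w \isn't a GRing.unit ->
       forall s, w s \isn't a GRing.unit) ->
  anisotropic cJ /\ forall d, represents cJ d ->
  exists y a, [/\ admissible V G e j y, a != 0
    & d = a ^+ 2 * (qform G y * qform G (e j))].
Proof.
move=> anis.
have prim (v : J -> F) : (exists s, v s != 0) -> exists (b : F) (w : J -> R),
    [/\ b != 0, dform rJ w \is a GRing.unit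
      & dform cJ v = b ^+ 2 * iota (dform rJ w)].
  move=> [s0 vs0].
  have [|s [_ vs vmin]] := valring_min dvrR unif fracF (s := enum {: J}) (x :=
    v).
    by apply/hasP; exists s0; rewrite ?mem_enum.
  have /choice[w wE] t : exists w, v t / v s = iota w.
    by apply: vmin; rewrite mem_enum.
  have ws : w s = 1.
    by case: fracF => inj _; apply: inj; rewrite -wE divff ?rmorph1.
  exists (v s), w; split=> //.
    apply/negPn/negP => /anis/(_ s); rewrite ws; by rewrite unitr1.
  rewrite rmorph_dform -dformZ; apply: eq_bigr => t _.
  by rewrite /= -wE [v s * _]mulrC divfK.
split=> [v v0 s | d [d0 [v dE]]].
  apply/eqP/negPn/negP => vs; have [|b [w [b0 wU E1]]] := prim v.
    by exists s.
  move/eqP: v0; rewrite E1 mulf_eq0 expf_eq0 (negPf b0) /= => /eqP w0.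
  by move: (rmorph_unit iota wU); rewrite w0 unitr0.
have [|b [w [b0 wU E1]]] := prim v.
  apply: contrapT => no; case/eqP: d0; rewrite dE; apply: big1 => s _.
  have [->|vs] := eqVneq (v s) 0; first by rewrite expr0n mulr0.
  by case: no; exists s.
have [y adm_y QyE] := unit_part_admissible wU.
exists y, (b / qform G (e j)); split=> //.
  by rewrite mulf_neq0 ?invr_neq0.
by rewrite dE E1 QyE; field.
Qed.

(** The unit [t] is a norm up to squares.  If the form is anisotropic modulo
    [pi], this follows from the norm principle over [F]. *)
Lemma unit_part_norm (u : J -> E) t :
    t \is a GRing.unit -> dform (fun s => (cJ s)%:A) u != 0 ->
    (exists2 z, z != 0
      & iota t = z ^+ 2 * fieldNorm (dform (fun s => (cJ s)%:A) u)) ->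
  exists (ys : seq 'rV[F]_n) a, [/\ forall y, y \in ys -> admissible V G e j y,
    a != 0 & iota t = a ^+ 2 * \prod_(y <- ys) (qform G y * qform G (e j))].
Proof.
move=> tU u0 [z z0 tE].
have [[w [s [wN wsU]]] | noiso] := pselect (exists w s,
    dform rJ w \isn't a GRing.unit /\ w s \is a GRing.unit).
  have [y [a [adm_y a0 E1]]] := unit_part_isotropic wN wsU tU.
  exists [:: y], a; rewrite big_seq1; split=> // v.
  by rewrite inE => /eqP->.
have [|anis rep] := unit_part_anisotropic.
  move=> w wN s; apply/negP => wsU; apply: noiso.
  by exists w, s.
have [b [ds [b0 dsP NE]]] := norm_principle two_neq0_frac anis u0.
suff [ys [a [adm_ys a0 E1]]] : exists (ys : seq 'rV[F]_n) a,
    [/\ forall y, y \in ys -> admissible V G e j y, a != 0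
      & \prod_(d <- ds) d = a ^+ 2 * \prod_(y <- ys) (qform G y * qform G (e
        j))].
  exists ys, (z * b * a); rewrite !mulf_neq0 //; split=> //.
  by rewrite tE NE E1; ring.
elim: ds dsP {NE} => [|d ds IHds] dsP.
  by exists [::], 1; rewrite !big_nil oner_neq0 expr1n mulr1.
have [|ys [a [adm_ys a0 E1]]] := IHds.
  by move=> d' d'ds; apply: dsP; rewrite inE d'ds orbT.
have [y [a' [adm_y a'0 E2]]] := rep d (dsP d (mem_head _ _)).
exists (y :: ys), (a' * a); rewrite mulf_neq0 // !big_cons E1; split=> //.
  by move=> v; rewrite inE => /orP[/eqP->|/adm_ys].
by rewrite {1}E2; ring.
Qed.

End Residual.

(** Divided by the value of [e j], the value of [u] is a unit [q] congruent
    modulo [pi] to a value [x0] of the unit part of the form, so that their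
    norms differ by a square.  Copies of [e j] account for the powers of its
    value and fix the parity. *)
Lemma fieldNorm_admissible j u : admissible S GE eE j u ->
  exists (vs : seq 'rV[F]_n) a,
    [/\ forall v, v \in vs -> admissible V G e j v,
        odd (size vs) = odd (\dim {:E}), a != 0
      & fieldNorm (qform GE u) = a ^+ 2 * \prod_(v <- vs) qform G v].
Proof.
move=> [uj]; set aj := qform G (e j).
have QeE i : qform GE (eE i) = (qform G (e i))%:A by apply: bform_extend.
rewrite QeE -/aj => ajE0 Qu0 Squ Suq.
have aj0 : aj != 0 by apply: contraNneq ajE0 => ->; rewrite scale0r.
have /choice[r rE] (i : 'I_k) : exists r,
  (j <= i)%N -> qform G (e i) = iota r * aj.
  have [ji|ji] := boolP (j <= i)%N; last by exists 0.
  by have [_ [r ->] ->] := chain_e ji; exists r.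
pose q := qform GE u / aj%:A.
have S1 : S 1 by apply: (integral1 (in_alg E \o iota)).
have SB := @integral_closureB _ _ iota E.
have [c [Sc c0 uE]] := tail_spanE S1 SB uj.
have orthE i l : i != l -> bform GE (eE i) (eE l) = 0.
  by move=> il; rewrite bform_extend orth_e // scale0r.
have symGE : GE^T = GE by rewrite /extend_mx map_trmx symG.
have qE : q = \sum_(i < k | (j <= i)%N) (iota (r i))%:A * c i ^+ 2.
  rewrite /q {1}uE /qform (bform_sumr symGE) mulr_suml [RHS]big_mkcond.
  apply: eq_bigr => i _; rewrite (bformZr symGE) (bform_sum_e orthE).
  have [ji|ij] := leqP j i; last by rewrite c0 ?mul0r.
  rewrite [qform _ _]QeE rE // -!in_algE rmorphM; field.
  exact: ajE0.
pose A := [pred i : 'I_k | (j <= i)%N && (r i \is a GRing.unit)].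
pose w (s : {i : 'I_k | i \in A}) := c (val s).
pose x0 := dform (fun s : {i : 'I_k | i \in A} => (iota (r (val s)))%:A) w.
have [z Sz qx0] : exists2 z, S z & q = x0 + (iota pi)%:A * z.
  have -> : x0 = \sum_(i in A) (iota (r i))%:A * c i ^+ 2.
    by rewrite [RHS]big_sub.
  rewrite qE (bigID (fun i => r i \is a GRing.unit)) /=.
  suff [z Sz ->] : exists2 z, S z & \sum_(i < k | (j <= i)%N
      && (r i \isn't a GRing.unit)) (iota (r i))%:A * c i ^+ 2
      = (iota pi)%:A * z by exists z.
  elim/big_ind: _ => [|_ _ [x Sx ->] [y Sy ->]|i /andP[ji /(nonunitP unif)[s
    sE]]].
  - by exists 0; rewrite ?mulr0 //; apply: (integral0 (in_alg E \o iota)).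
  - by exists (x + y); rewrite ?mulrDr //; apply: integral_add.
  exists ((iota s)%:A * c i ^+ 2); last first.
    by rewrite sE -!in_algE !rmorphM; ring.
  apply: integral_closureM; last exact: integral_closureM.
  by apply: integral_closure_valring; eexists.
have q0 : q != 0 by rewrite mulf_neq0 ?invr_eq0.
have Sqz : S (- (z / q)).
  by apply/integral_opp/integral_closureM => //; rewrite /q invf_div.
have x0E : x0 = q * (1 + (iota pi)%:A * - (z / q)).
  have -> : x0 = q - (iota pi)%:A * z by rewrite qx0 addrK.
  by field.
have [s sE] := fieldNorm_1pi dvrR unif fracF Sqz.
have [z1 [z10 z1E]] := valring_sqrt_1pi dvrR unif cR two_unit fracF s.
have Nx0 : fieldNorm x0 = fieldNorm q * iota z1 ^+ 2.
  by rewrite x0E fieldNormM sE z1E.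
have Nq0 := fieldNorm_neq0 q0.
have x00 : x0 != 0.
  apply: contraTneq (mulf_neq0 Nq0 (expf_neq0 2 z10)) => x00.
  rewrite -Nx0 x00 -(scale0r (1 : E)) fieldNorm_alg expr0n.
  by rewrite eqn0Ngt adim_gt0 eqxx.
have [t tE] := fieldNorm_integral dvrR unif fracF (Squ : S q).
have tU : t \is a GRing.unit.
  apply: (valringV_unit fracF); last by rewrite -(iota_eq0 fracF) -tE.
  rewrite -tE -fieldNormV //; apply: (fieldNorm_integral dvrR unif fracF).
  by rewrite /q invf_div.
have [||ys [a [adm_ys a0 tE']]] := @unit_part_norm j r aj0 rE w t tU.
- exact: x00.
- exists (iota z1)^-1; first by rewrite invr_eq0.
  by rewrite -[dform _ _]/x0 Nx0 -tE; field.
have adm_e : admissible V G e j (e j).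
  by split=> //; rewrite ?divff //; apply: tail_span_e.
exists (ys ++ nseq (size ys + \dim {:E}) (e j)), a; split=> //.
- by move=> v; rewrite mem_cat mem_nseq => /orP[/adm_ys //|/andP[_ /eqP->]].
- by rewrite size_cat size_nseq addnA addnn oddD odd_double.
have -> : qform GE u = aj%:A * q by rewrite mulrC divfK.
rewrite fieldNormM fieldNorm_alg tE tE' big_cat /= -/aj.
have -> : \prod_(v <- nseq (size ys + \dim {:E}) (e j)) qform G v
    = aj ^+ (size ys + \dim {:E}).
  elim: (_ + _)%N => [|m IHm]; first by rewrite big_nil.
  by rewrite big_cons IHm exprS.
have -> : \prod_(y <- ys) (qform G y * aj)
    = \prod_(y <- ys) qform G y * aj ^+ size ys.
  elim: (ys) => [|y l IHl]; first by rewrite !big_nil mulr1.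
  by rewrite !big_cons IHl exprS; ring.
by rewrite exprD; ring.
Qed.

Lemma fieldNorm_admissible_prod us :
    (forall u, u \in us -> exists j, admissible S GE eE j u) ->
  exists (vs : seq 'rV[F]_n) a,
    [/\ forall v, v \in vs -> exists j, admissible V G e j v,
        odd (size vs) = odd (size us * \dim {:E}), a != 0
      & fieldNorm (\prod_(u <- us) qform GE u)
          = a ^+ 2 * \prod_(v <- vs) qform G v].
Proof.
elim: us => [|u us IHus] adm_us.
  by exists [::], 1; rewrite !big_nil oner_neq0 fieldNorm1 expr1n mulr1.
have [|vs [a [adm_vs odd_vs a0 NE]]] := IHus.
  by move=> v vus; apply: adm_us; rewrite inE vus orbT.
have [j /fieldNorm_admissible[ws [b [adm_ws odd_ws b0 NE']]]] :=
  adm_us u (mem_head _ _).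
exists (ws ++ vs), (b * a); rewrite mulf_neq0 //; split=> //.
- by move=> v; rewrite mem_cat => /orP[/adm_ws|/adm_vs //]; exists j.
- by rewrite size_cat mulSn !oddD odd_ws odd_vs.
by rewrite big_cons fieldNormM NE NE' big_cat /=; ring.
Qed.

End AdmissibleNorm.

(** * Norms of spinor norms *)

Theorem theorem3p10 (R : idomainType) (F : fieldType)
    (iota : {rmorphism R -> F}) (E : fieldExtType F)
    (n : nat) (G : 'M[F]_n) (M : set 'rV[F]_n)
    (S := integral_closure iota E)
    (GE := extend_mx E G) (ME := extend_lattice S M) :
  dvr R -> complete R -> (2%:R : R) \is a GRing.unit ->
  is_fraction_field iota ->
  nondeg_symmetric G -> is_lattice iota M ->
  (@fieldNorm F E) @` spinor_norms GE (Olat GE ME)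
      `<=` spinor_norms G (Olat G M) /\
  (@fieldNorm F E) @` spinor_norms GE (SOlat GE ME)
      `<=` spinor_norms G (SOlat G M).
Proof.
move=> dvrR cR two_unit fracF ndG latM.
have [symG uG] := ndG.
have [pi unif] : exists pi : R, uniformizer pi by case: dvrR => pid /pid.
have [k [e [orth_e chain_e anis_e span_e MeE]]] :=
  diagonal_basis dvrR unif two_unit fracF ndG latM.
pose eE i := extend_mx E (e i).
have MEe : ME = lattice_span S eE by apply: extend_lattice_span.
have two_F := two_neq0_frac two_unit iota.
have two_E : (2%:R : E) != 0 by rewrite -(rmorph_nat (in_alg E)) fmorph_eq0.
have symGE : GE^T = GE by rewrite /GE /extend_mx map_trmx symG.
have uGE : GE \in unitmx by rewrite /GE /extend_mx map_unitmx.
have key s c : Olat GE ME s -> spinor_norm GE s c ->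
    exists vs : seq 'rV[F]_n, [/\ Olat G M (reflections_mx G vs),
      \det s = 1 -> \det (reflections_mx G vs) = 1
      & spinor_norm G (reflections_mx G vs) (fieldNorm c)].
  move=> [[sU Qs] sM] [us0 [a0 [Qus0 sus0 a00 ->]]].
  have S1 : S 1 by apply: (integral1 (in_alg E \o iota)).
  have SB := @integral_closureB _ _ iota E.
  have SM := @integral_closureM _ _ iota E.
  have QeE i : qform GE (eE i) = (qform G (e i))%:A by apply: bform_extend.
  have orthE i l : i != l -> bform GE (eE i) (eE l) = 0.
    by move=> il; rewrite bform_extend orth_e // scale0r.
  have chainE (i j : 'I_k) : (i <= j)%N ->
      exists2 r, S r & qform GE (eE j) = r * qform GE (eE i).
    move=> /chain_e[r Vr rE]; exists r%:A;
      first exact: integral_closure_valring.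
    by rewrite !QeE rE mulr_algl scalerA.
  have halfE : S 2%:R^-1.
    have -> : (2%:R : E)^-1 = (iota 2%:R^-1)%:A.
      by rewrite rmorphV // rmorph_nat -in_algE fmorphV rmorph_nat.
    by apply: integral_closure_valring; eexists.
  have anisE i : qform GE (eE i) = 0 -> eE i = 0.
    rewrite QeE => /eqP; rewrite scaler_eq0 oner_eq0 orbF => /eqP/anis_e ei0.
    by rewrite /eE ei0 /extend_mx map_mx0.
  have [|us [adm_us sus]] := kneser_generation S1 SM SB symGE orthE chainE two_E
    halfE (integral_closure_local dvrR unif cR two_unit fracF (E := E)) anisE
    (extend_span span_e) Qs.
    move=> x; rewrite -MEe => MEx; rewrite -sM; by exists x.
  have Qus u : u \in us -> qform GE u != 0 by move=> /adm_us[j []].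
  have [|b b0 prodE] := prod_qform_unique symGE two_E uGE Qus0 Qus.
    by move=> x; rewrite -sus0 -sus.
  have [vs [a [adm_vs odd_vs a_neq0 NE]]] :=
    fieldNorm_admissible_prod dvrR unif cR two_unit fracF symG orth_e chain_e
      adm_us.
  have Qvs v : v \in vs -> qform G v != 0 by move=> /adm_vs[j []].
  exists vs; split.
  - rewrite MeE; apply: (reflections_mx_Olat _ _ _ symG orth_e chain_e adm_vs).
    + exact: valring1.
    + exact: valringM.
    + exact: valringB.
  - move=> det_s; rewrite det_reflections_mx // -signr_odd odd_vs oddM.
    suff -> : odd (size us) = false by rewrite expr0.
    apply/negP => odd_us; have : \det (reflections_mx GE us) = 1.
      rewrite -det_s; congr (\det _); apply/row_matrixP=> i.
      by rewrite !rowE sus mul_reflections_mx.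
    rewrite det_reflections_mx // -signr_odd odd_us expr1 => /eqP.
    by rewrite eq_sym -addr_eq0 -mulr2n (negPf two_E).
  (* [us0] and [us] have the same product of reflections, so that [b] relates
     their values. *)
  exists vs, (fieldNorm (a0 * b) * a); split=> //.
  - by move=> x; rewrite mul_reflections_mx.
  - by rewrite mulf_neq0 // fieldNorm_neq0 // mulf_neq0.
  rewrite prodE mulrA -exprMn fieldNormM NE expr2 fieldNormM.
  by rewrite -expr2 exprMn mulrA.
split=> [_ [c [s Os sc] <-]|_ [c [s [Os [_ det_s]] sc] <-]].
  by have [vs [Ovs _ vsc]] := key s c Os sc; exists (reflections_mx G vs).
have [vs [Ovs det_vs vsc]] := key s c Os sc.
exists (reflections_mx G vs) => //; split=> //; split; first by case: Ovs.
exact: det_vs.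
Qed.
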